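(* The Hilbert space $\ell_2$ is arbitrarily distortable: for every $\lambda>1$ there exists a norm $|\cdot|$ on $\ell_2$, equivalent to the usual norm $\|\cdot\|_2$, such that for every infinite dimensional closed linear subspace $Y$ of $\ell_2$ there exist $x,y\in Y$ with $\|x\|_2=\|y\|_2=1$ and $|x|>\lambda|y|$.
   Context: $\ell_2$ is the real Hilbert space of square summable sequences with norm $\|\cdot\|_2$. *)

(* Defs.v *)
From HB Require Import structures.
From mathcomp Require Import all_boot all_order all_algebra.
From mathcomp Require Import mathcomp_extra boolp classical_sets functions.
From mathcomp Require Import reals topology normedtype sequences.
From mathcomp Require Import ring.

Set Implicit Arguments.
Unset Strict Implicit.
Unset Printing Implicit Defensive.

Import Order.TTheory GRing.Theory Num.Theory.
Import numFieldNormedType.Exports.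

Local Open Scope classical_set_scope.
Local Open Scope ring_scope.

Section SquareSummable.
Variable R : realType.
Implicit Types x y : nat -> R.

Definition square_summable : {pred (nat -> R)} :=
  [pred x : nat -> R | `[< cvgn (series (fun n => x n ^+ 2)) >]].

Definition l2norm x : R := Num.sqrt (limn (series (fun n => x n ^+ 2))).

Lemma square_summableP x :
  reflect (cvgn (series (fun n => x n ^+ 2))) (x \in square_summable).
Proof. exact: asboolP. Qed.

Lemma nd_sqseries x : nondecreasing_seq (series (fun n => x n ^+ 2)).
Proof. by apply: nondecreasing_series => n _ _; exact: sqr_ge0. Qed.

Lemma sqseries_le_lim x n : x \in square_summable ->
  series (fun n => x n ^+ 2) n <= limn (series (fun n => x n ^+ 2)).
Proof.
move=> /square_summableP cx.
by apply: nondecreasing_cvgn_le => //; exact: nd_sqseries.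
Qed.

Lemma sqlim_ge0 x : x \in square_summable ->
  0 <= limn (series (fun n => x n ^+ 2)).
Proof.
by move=> /(@sqseries_le_lim x 0%N); rewrite /series /= big_geq.
Qed.

Lemma square_summable_bound x (M : R) :
    (forall n, series (fun n => x n ^+ 2) n <= M) ->
  x \in square_summable /\ limn (series (fun n => x n ^+ 2)) <= M.
Proof.
move=> xM; have cx : cvgn (series (fun n => x n ^+ 2)).
  apply: nondecreasing_is_cvgn; first exact: nd_sqseries.
  by exists M => _ [n _ <-].
split; first exact/square_summableP.
by apply: limr_le => //; apply: nearW.
Qed.

Lemma l2norm_sqr x : x \in square_summable ->
  l2norm x ^+ 2 = limn (series (fun n => x n ^+ 2)).
Proof. by move=> xs; rewrite sqr_sqrtr// sqlim_ge0. Qed.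

Lemma l2norm_coord x n : x \in square_summable -> `|x n| <= l2norm x.
Proof.
move=> xs; rewrite -sqrtr_sqr ler_wsqrtr//.
apply: le_trans (sqseries_le_lim n.+1 xs); rewrite /series /= big_nat_recr//=.
by rewrite lerDr sumr_ge0// => i _; exact: sqr_ge0.
Qed.

Lemma l2normP x (M : R) : 0 <= M ->
    (forall n, series (fun n => x n ^+ 2) n <= M ^+ 2) ->
  x \in square_summable /\ l2norm x <= M.
Proof.
move=> M0 /square_summable_bound[xs xM]; split=> //.
by rewrite -(ler_pXn2r (_ : 0 < 2)%N) ?nnegrE ?sqrtr_ge0// l2norm_sqr.
Qed.

Lemma l2norm_eq0 x : x \in square_summable -> l2norm x = 0 -> x = 0.
Proof.
move=> xs x0; apply/funext => n; apply/eqP; rewrite -normr_le0 -x0.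
exact: l2norm_coord.
Qed.

Lemma square_summable0 : (0 : nat -> R) \in square_summable.
Proof.
have [|//] := @l2normP (0 : nat -> R) 0 (lexx _).
by move=> n; rewrite /series /= big1 ?expr0n// => i _; rewrite expr0n.
Qed.

Lemma l2normD x y : x \in square_summable -> y \in square_summable ->
  (x + y) \in square_summable /\ l2norm (x + y) <= l2norm x + l2norm y.
Proof.
move=> xs ys; have := sqrtr_ge0 (limn (series (fun n => y n ^+ 2))).
have := sqrtr_ge0 (limn (series (fun n => x n ^+ 2))).
rewrite -/(l2norm x) -/(l2norm y) le_eqVlt => /predU1P[x0|x0].
  by rewrite (l2norm_eq0 xs (esym x0)) add0r => y0; split=> //; rewrite lerDr sqrtr_ge0.
rewrite le_eqVlt => /predU1P[y0|y0].
  by rewrite (l2norm_eq0 ys (esym y0)) addr0; split=> //; rewrite lerDl sqrtr_ge0.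
set a := l2norm x in x0 *; set b := l2norm y in y0 *.
apply: l2normP => [|n]; first by rewrite addr_ge0// ltW.
have -> : (a + b) ^+ 2 = (1 + b / a) * a ^+ 2 + (1 + a / b) * b ^+ 2.
  by field; rewrite !gt_eqF.
apply: (@le_trans _ _ ((1 + b / a) * series (fun n => x n ^+ 2) n +
                       (1 + a / b) * series (fun n => y n ^+ 2) n)); last first.
  have [a0 b0] := (ltW x0, ltW y0).
  apply: lerD; apply: ler_wpM2l; rewrite ?addr_ge0 ?divr_ge0//.
    by rewrite l2norm_sqr//; exact: sqseries_le_lim.
  by rewrite l2norm_sqr//; exact: sqseries_le_lim.
rewrite /series /= !mulr_sumr -big_split /=; apply: ler_sum => i _.
rewrite -[(x + y) i]/(x i + y i) -subr_ge0.
have -> : (1 + b / a) * x i ^+ 2 + (1 + a / b) * y i ^+ 2 - (x i + y i) ^+ 2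
   = (b * x i - a * y i) ^+ 2 / (a * b) by field; rewrite !gt_eqF.
by rewrite divr_ge0 ?sqr_ge0// mulr_ge0 ?ltW.
Qed.

Lemma l2normZ (c : R) x : x \in square_summable ->
  (c *: x) \in square_summable /\ l2norm (c *: x) = `|c| * l2norm x.
Proof.
move=> /[dup] xs /square_summableP cx.
have E : series (fun n => (c *: x) n ^+ 2) =
    (fun n => c ^+ 2 * series (fun n => x n ^+ 2) n).
  apply/funext => n; rewrite /series /= mulr_sumr.
  by apply: eq_bigr => i _; rewrite -exprMn.
have L : (fun n => c ^+ 2 * series (fun n => x n ^+ 2) n) @ \oo -->
    c ^+ 2 * limn (series (fun n => x n ^+ 2)).
  by apply: cvgM => //; exact: cvg_cst.
split; first by apply/square_summableP; rewrite E; apply/cvg_ex; eexists; exact: L.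
rewrite /l2norm E (cvg_lim _ L)//.
by rewrite sqrtrM ?sqr_ge0// sqrtr_sqr.
Qed.

Lemma square_summable_submod_closed : submod_closed square_summable.
Proof.
split=> [|c x y xs ys]; first exact: square_summable0.
by have [cxs _] := l2normZ c xs; have [] := l2normD cxs ys.
Qed.

HB.instance Definition _ := GRing.isSubmodClosed.Build R (nat -> R)
  square_summable square_summable_submod_closed.

(* A record rather than a sigma type, so that the only topology on it is the
   one of the norm declared below. *)
Record ell2 : Type := Ell2 {
  ell2_seq :> nat -> R;
  _ : ell2_seq \in square_summable }.

HB.instance Definition _ := [isSub for ell2_seq].
HB.instance Definition _ := [Choice of ell2 by <:].
HB.instance Definition _ := [SubChoice_isSubLmodule of ell2 by <:].

Definition ell2_norm (x : ell2) : R := l2norm x.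

Lemma ell2_normD (x y : ell2) : ell2_norm (x + y) <= ell2_norm x + ell2_norm y.
Proof. by have [] := l2normD (valP x) (valP y). Qed.

Lemma ell2_normZ (c : R) (x : ell2) : ell2_norm (c *: x) = `|c| * ell2_norm x.
Proof. by have [] := l2normZ c (valP x). Qed.

Lemma ell2_norm0_eq0 (x : ell2) : ell2_norm x = 0 -> x = 0.
Proof. by move=> x0; apply: val_inj; exact: l2norm_eq0 (valP x) x0. Qed.

HB.instance Definition _ := Lmodule_isNormed.Build R ell2
  ell2_normD ell2_normZ ell2_norm0_eq0.

End SquareSummable.

Lemma ell2_normE (R : realType) (x : ell2 R) :
  `|x| = Num.sqrt (limn (series (fun n => (x : nat -> R) n ^+ 2))).
Proof. by []. Qed.

Section Norms.
Variables (R : realType) (V : lmodType R).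
Implicit Types (p q : V -> R) (Y : set V).

(* Nonnegativity and p 0 = 0 follow from the first two conditions. *)
Definition is_norm p : Prop :=
  [/\ forall x y, p (x + y) <= p x + p y,
      forall (a : R) x, p (a *: x) = `|a| * p x &
      forall x, p x = 0 -> x = 0].

Definition equivalent_norms p q : Prop :=
  exists c C : R,
    [/\ 0 < c, 0 < C & forall x, c * q x <= p x /\ p x <= C * q x].

(* Meant for linear subspaces Y: then Y is the span of b. *)
Definition finite_dimensional Y : Prop :=
  exists (n : nat) (b : 'I_n -> V),
    (forall i, Y (b i)) /\
    (forall y, Y y -> exists a : 'I_n -> R, y = \sum_(i < n) a i *: b i).

Definition infinite_dimensional Y : Prop := ~ finite_dimensional Y.

End Norms.

(* Main.v *)
Require Import Defs.
From mathcomp Require Import all_boot all_order all_algebra.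
From mathcomp Require Import mathcomp_extra boolp classical_sets functions.
From mathcomp Require Import reals topology normedtype sequences exp.
From mathcomp Require Import ring lra zify.
Set Implicit Arguments.
Unset Strict Implicit.
Unset Printing Implicit Defensive.
Import Order.TTheory GRing.Theory Num.Theory.
Import numFieldNormedType.Exports.
Local Open Scope classical_set_scope.
Local Open Scope ring_scope.

(** The distorting norm is built from Schlumprecht's space S, with f (l) = weight l
    in place of log_2 (1 + l); a prime marks elements of the dual of S.  If x and x'
    are nonnegative, in the unit balls of S and of its dual, then sqrt (x x') lies in
    the unit ball of l_2, and < sqrt (x x'), sqrt (y y') > ^2 <= y' (x) x' (y) by
    Cauchy-Schwarz.  Take for y an l_1^k-average with k >= n, and for x the average of
    n rapidly increasing such averages x_j, with x' = x_1' + ... + x_n': then x' (y) is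
    bounded, as y is insensitive to being cut into n pieces, while y' (x) <= ||x|| is
    small because averages of rapidly increasing sequences tend to 0 in S.  Hence the
    norm u |-> sup < sqrt (y y'), |u| > over all such pairs (y, y') is large at the
    vectors sqrt (y y') and small at the vectors sqrt (x x').

    Both kinds must be found in every block subspace of l_2, that is, for every
    sequence of block probabilities P_i, some convex combination h of them must factor
    as h = y y' with y an l_1^k-average.  Every h factors as h = y y' where y maximizes
    the entropy sum_i h_i ln y_i over the unit ball (Lozanovskii).  The maximal entropy
    is almost additive at some level of iterated averaging of the P_i (an argument in
    the style of James); at that level the average of the maximizers of k successive
    pieces, which is an l_1^k-average, is almost a maximizer for the average of the
    pieces, so that it is close to the true one on most of the mass of h. *)

(** * Schlumprecht's space and its l_1-averages *)

Section Schlumprecht.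
Variable R : realType.
Implicit Types (x y z phi : nat -> R) (a b : nat -> nat).

Definition weight (l : nat) : R := (trunc_log 2 l).+1%:R.

Definition pairing N phi x : R := \sum_(i < N) phi i * x i.

Definition segment (s t : nat) x : nat -> R :=
  fun j => if (s <= j < t)%N then x j else 0.

Definition nondecreasing a := {homo a : i j / (i <= j)%N >-> (i <= j)%N}.

(* The standard norming set of S.  The segments need not contain the supports, so that
   the set is closed under restriction to intervals. *)
Inductive norming : (nat -> R) -> Prop :=
| norming_coord i : norming (fun j => (j == i)%:R)
| norming_join l a (phi : nat -> nat -> R) :
    (1 < l)%N -> nondecreasing a -> (forall i, norming (phi i)) ->
    norming (fun j =>
      (\sum_(i < l) segment (a i) (a i.+1) (phi i) j) / weight l).

(* The norm of S is only used on nonnegative vectors, through its sublevel sets. *)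
Definition snorm_le x (t : R) :=
  (forall j, 0 <= x j) /\ forall phi N, norming phi -> pairing N phi x <= t.

Definition supported (s t : nat) x := forall j, ~~ (s <= j < t)%N -> x j = 0.

Lemma weight_ge1 l : 1 <= weight l.
Proof. by rewrite /weight ler1n. Qed.

Lemma weight_gt0 l : 0 < weight l.
Proof. exact: lt_le_trans (weight_ge1 l). Qed.

Lemma weight_ge2 l : (1 < l)%N -> 2 <= weight l.
Proof. by move=> l1; rewrite /weight ler_nat ltnS trunc_log_gt0. Qed.

Lemma weight_le l m : (l <= m)%N -> weight l <= weight m.
Proof. by move=> lm; rewrite /weight ler_nat ltnS leq_trunc_log. Qed.

Lemma weight_unbounded (M : R) : exists l, (1 < l)%N /\ M <= weight l.
Proof.
have [n Mn] : exists n : nat, M <= n%:R.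
  by exists (Num.truncn `|M|).+1; rewrite (le_trans (ler_norm _))// ltW// truncnS_gt.
exists (2 ^ n.+1)%N; split; first by rewrite expnS; have := expn_gt0 2 n; lia.
rewrite /weight trunc_expnK// (le_trans Mn)// ler_nat; lia.
Qed.

Lemma count_segment a n j : nondecreasing a ->
  \sum_(i < n) ((a i <= j < a i.+1)%N : nat)%:R <= 1 :> R.
Proof.
move=> nda; elim: n => [|n IH]; first by rewrite big_ord0.
rewrite big_ord_recr /=; have [/andP[h1 h2]|_] := boolP (a n <= j < a n.+1)%N;
  last by rewrite addr0.
rewrite big1 ?add0r// => i _; have : (a i.+1 <= a n)%N by apply: nda.
by case: (boolP (_ <= j < _)%N) => // /andP[] *; lia.
Qed.

Lemma segmentE s t x j : segment s t x j = (s <= j < t)%N%:R * x j.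
Proof. by rewrite /segment; case: ifP; rewrite ?mul1r ?mul0r. Qed.

Lemma norming_bound phi : norming phi -> forall j, 0 <= phi j <= 1.
Proof.
elim=> [i j|l a f l1 nda _ IH j]; first by case: (j == i); rewrite /= lexx ?ler01.
have w0 := weight_gt0 l; apply/andP; split.
  rewrite divr_ge0 ?(ltW w0)// sumr_ge0// => i _.
  by rewrite segmentE mulr_ge0//; have /andP[] := IH i j.
rewrite ler_pdivrMr// mul1r (le_trans _ (weight_ge1 l))//.
apply: le_trans (count_segment l j nda); apply: ler_sum => i _.
by rewrite segmentE ler_piMr//; have /andP[] := IH i j.
Qed.

Lemma pairing_mono N M phi x : (N <= M)%N ->
  (forall j, 0 <= phi j) -> (forall j, 0 <= x j) -> pairing N phi x <= pairing M phi x.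
Proof.
move=> NM p0 x0; rewrite /pairing -!(big_mkord predT (fun i => phi i * x i)).
rewrite (big_cat_nat _ NM)//= lerDl sumr_ge0// => i _; exact: mulr_ge0.
Qed.

Lemma pairing_segmentC N phi x s t :
  pairing N (segment s t phi) x = pairing N phi (segment s t x).
Proof. by apply: eq_bigr => i _; rewrite !segmentE; ring. Qed.

Lemma pairing_sumr N phi n (z : nat -> nat -> R) (P : pred nat) :
  pairing N phi (fun j => \sum_(i < n | P i) z i j) =
  \sum_(i < n | P i) pairing N phi (z i).
Proof.
rewrite /pairing exchange_big /=; apply: eq_bigr => i _; exact: mulr_sumr.
Qed.

Lemma pairing_suml N n (z : nat -> nat -> R) x :
  pairing N (fun j => \sum_(i < n) z i j) x = \sum_(i < n) pairing N (z i) x.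
Proof.
rewrite /pairing exchange_big /=; apply: eq_bigr => i _; exact: mulr_suml.
Qed.

Lemma pairingZr N phi c x : pairing N phi (fun j => c * x j) = c * pairing N phi x.
Proof. by rewrite /pairing mulr_sumr; apply: eq_bigr => i _; ring. Qed.

Lemma pairingZl N phi c x : pairing N (fun j => c * phi j) x = c * pairing N phi x.
Proof. by rewrite /pairing mulr_sumr; apply: eq_bigr => i _; ring. Qed.

Lemma pairing_ler N phi x y : (forall j, 0 <= phi j) -> (forall j, x j <= y j) ->
  pairing N phi x <= pairing N phi y.
Proof. by move=> p0 xy; apply: ler_sum => i _; apply: ler_wpM2l. Qed.

Lemma pairing_join N l a (f : nat -> nat -> R) x :
  pairing N (fun j => (\sum_(i < l) segment (a i) (a i.+1) (f i) j) / weight l) x =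
  (\sum_(i < l) pairing N (f i) (segment (a i) (a i.+1) x)) / weight l.
Proof.
rewrite (_ : (fun j => _) = fun j => (weight l)^-1 * (\sum_(i < l) segment (a i) (a i.+1) (f i)
  j)); last first.
  by apply/funext => j; rewrite mulrC.
rewrite pairingZl (@pairing_suml N l (fun i => segment (a i) (a i.+1) (f i)) x) mulrC;
  congr (_ * _); apply: eq_bigr => i _.
exact: pairing_segmentC.
Qed.

Lemma snorm_le_coord x t j : snorm_le x t -> x j <= t.
Proof.
case=> x0 /(_ _ j.+1 (norming_coord j)); apply: le_trans.
by rewrite /pairing big_ord_recr /= eqxx mul1r lerDr sumr_ge0// => i _; rewrite mulr_ge0.
Qed.

Lemma snorm_le_mono x y t : (forall j, 0 <= x j <= y j) -> snorm_le y t -> snorm_le x t.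
Proof.
move=> xy [y0 yt]; split=> [j|phi N nphi]; first by have /andP[] := xy j.
apply: le_trans (yt _ N nphi); apply: pairing_ler => j.
  by have /andP[] := norming_bound nphi j.
by have /andP[] := xy j.
Qed.

Lemma snorm_le_segment x t s r : snorm_le x t -> snorm_le (segment s r x) t.
Proof.
move=> xt; apply: snorm_le_mono (xt) => j; rewrite segmentE.
have x0 := xt.1 j; by case: (_ <= _ < _)%N; rewrite ?mul1r ?mul0r lexx x0.
Qed.

Lemma snorm_leZ c x t : 0 <= c -> snorm_le x t -> snorm_le (fun j => c * x j) (c * t).
Proof.
move=> c0 [x0 xt]; split=> [j|phi N h]; first by rewrite mulr_ge0.
by rewrite pairingZr ler_wpM2l// xt.
Qed.

Lemma snorm_le_sum n (z : nat -> nat -> R) (t : nat -> R) :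
  (forall i, (i < n)%N -> snorm_le (z i) (t i)) ->
  snorm_le (fun j => \sum_(i < n) z i j) (\sum_(i < n) t i).
Proof.
move=> h; split=> [j|phi N p]; first by apply: sumr_ge0 => i _; exact: (h i (ltn_ord i)).1.
rewrite (@pairing_sumr N phi n z predT); apply: ler_sum => i _; exact: (h i (ltn_ord i)).2.
Qed.

Lemma snorm_le0 x t : 0 <= t -> (forall j, x j = 0) -> snorm_le x t.
Proof.
move=> t0 x0; split=> [j|phi N _]; first by rewrite x0.
by rewrite /pairing big1// => i _; rewrite x0 mulr0.
Qed.

Lemma segment_supported s t x : supported s t (segment s t x).
Proof. by move=> j; rewrite /segment; case: ifP. Qed.

Lemma segment_id s t x : supported s t x -> segment s t x = x.
Proof. by move=> h; apply/funext => j; rewrite /segment; case: ifPn => // /h. Qed.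

Lemma segment_ge0 s t x j : (forall j, 0 <= x j) -> 0 <= segment s t x j.
Proof. by move=> x0; rewrite segmentE mulr_ge0. Qed.

(* [t i] stands for the norm in S of the [i]-th piece of [x]. *)
Definition split_bound l (c : R) x := forall a, nondecreasing a ->
  exists t : nat -> R, (forall i, snorm_le (segment (a i) (a i.+1) x) (t i)) /\
    \sum_(i < l) t i <= c.

(** Almost optimal functionals for the [l] pieces join into one norming functional at the cost of
    the factor [weight l]. The bounds [t i] are suprema of pairings, approached within [e / l]. *)
Lemma snorm_le_split x l : (1 < l)%N -> snorm_le x 1 -> split_bound l (weight l) x.
Proof.
move=> l1 x1 a nda.
pose S i := [set r : R | exists phi N, norming phi /\ r = pairing N phi (segment (a i) (a i.+1) x)].
have S0 i : S i !=set0.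
  by exists (pairing 0 (fun j => (j == 0)%:R) (segment (a i) (a i.+1) x)), (fun j =>
    (j == 0)%:R), 0%N; split=> //; exact: norming_coord.
have SU i : has_sup (S i).
  split=> //; exists 1 => r [phi [N [h ->]]].
  exact: (snorm_le_segment (a i) (a i.+1) x1).2.
exists (fun i => sup (S i)); split=> [i|].
  split=> [j|phi N h]; first exact: segment_ge0 x1.1.
  by apply: sup_upper_bound => //; exists phi, N.
apply/ler_addgt0Pl => e e0.
have e'0 : 0 < e / l%:R by rewrite divr_gt0// ltr0n; lia.
have H i : exists p : (nat -> R) * nat, norming p.1 /\
    sup (S i) - e / l%:R < pairing p.2 p.1 (segment (a i) (a i.+1) x).
  have [r [phi [N [h ->]]] hr] := sup_adherent e'0 (SU i).
  by exists (phi, N).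
have [g Hg] := choice H.
pose M := \max_(i < l) (g i).2.
have Hj := norming_join l1 nda (fun i => (Hg i).1).
have := x1.2 _ M Hj; rewrite (@pairing_join M l a (fun i =>
  (g i).1) x) ler_pdivrMr ?weight_gt0// mul1r => HM.
apply: (@le_trans _ _ (e + \sum_(i < l) pairing M (g i).1 (segment (a i) (a i.+1) x)));
  last by rewrite lerD2l.
have -> : e = \sum_(i < l) e / l%:R.
  by rewrite sumr_const card_ord -[RHS]mulr_natr divfK// pnatr_eq0; lia.
rewrite -big_split /=; apply: ler_sum => i _; rewrite -lerBlDl ltW//.
apply: lt_le_trans (Hg i).2 _; apply: pairing_mono.
- exact: (leq_bigmax i).
- by move=> j; have /andP[] := norming_bound (Hg i).1 j.
- by move=> j; apply: segment_ge0 x1.1.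
Qed.

(** The one feature of l_1^k-averages that the argument uses. A general vector of the unit ball only
    has [weight l] in place of 2. *)
Definition flat k y := snorm_le y 1 /\ forall l, (l <= k)%N -> split_bound l 2 y.

(* Two families of [n] and [l] successive intervals have at most [n + l] intersecting pairs. *)
Lemma flat_average n (z : nat -> nat -> R) b : (0 < n)%N -> nondecreasing b ->
  (forall m, (m < n)%N -> snorm_le (z m) 1 /\ supported (b m) (b m.+1) (z m)) ->
  flat n (fun j => n%:R^-1 * \sum_(m < n) z m j).
Proof.
move=> n0 ndb Hz; have n0R : 0 < n%:R :> R by rewrite ltr0n.
have ni0 : 0 <= n%:R^-1 :> R by rewrite invr_ge0 ltW.
split.
  have := snorm_leZ ni0 (snorm_le_sum (fun m h => (Hz m h).1)).
  by rewrite sumr_const card_ord mulVf// gt_eqF.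
move=> l ln a nda.
(* Two intervals meet only if one of them contains the left end of the other. Each left end lies in
   at most one interval of the other family, whence the count [n + l]. *)
pose meets i m : bool := (b m <= a i < b m.+1)%N || (a i <= b m < a i.+1)%N.
exists (fun i => n%:R^-1 * \sum_(m < n) (meets i m)%:R); split=> [i|].
  rewrite (_ : segment _ _ _ = fun j => n%:R^-1 * \sum_(m < n) segment (a i) (a i.+1) (z m) j).
    apply: snorm_leZ => //.
    apply: (snorm_le_sum (z := fun m => segment (a i) (a i.+1) (z m)) (t := fun m =>
      (meets i m)%:R)) => m mn.
    have [h|h] := boolP (meets i m); first exact: snorm_le_segment (Hz m mn).1.
    apply: snorm_le0 => // j; rewrite segmentE.
    have [/andP[h1 h2]|] := boolP (a i <= j < a i.+1)%N; last by rewrite mul0r.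
    rewrite (Hz m mn).2 ?mulr0//; move: h; rewrite /meets; lia.
  by apply/funext => j; rewrite segmentE mulrCA mulr_sumr; congr (_ * _); apply: eq_bigr => m _;
    rewrite segmentE.
rewrite -mulr_sumr ler_pdivrMl//.
apply: (@le_trans _ _ (\sum_(i < l) \sum_(m < n) ((b m <= a i < b m.+1)%N%:R + (a i <= b m < a
  i.+1)%N%:R))).
  apply: ler_sum => i _; apply: ler_sum => m _; rewrite /meets -natrD ler_nat.
  by case: (_ <= _ < _)%N; case: (_ <= _ < _)%N.
under eq_bigr do rewrite big_split /=.
rewrite big_split /= [X in _ + X]exchange_big /=.
rewrite (_ : n%:R * 2 = n%:R + n%:R); last by ring.
apply: lerD.
  apply: (@le_trans _ _ (\sum_(i < l) 1)); first by apply: ler_sum => i _; exact: count_segment.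
  by rewrite sumr_const card_ord ler_nat.
apply: (@le_trans _ _ (\sum_(i < n) 1)); first by apply: ler_sum => i _; exact: count_segment.
by rewrite sumr_const card_ord.
Qed.

End Schlumprecht.

Arguments weight {R} l.
Arguments count_segment {R a} n j nda.
Arguments weight_gt0 {R} l.
Arguments weight_ge1 {R} l.
Arguments weight_ge2 {R l} _.
Arguments weight_le {R l m} _.
Arguments norming_coord {R} i.

(** * Averages of rapidly increasing sequences *)

Section RapidlyIncreasing.
Variable R : realType.
Implicit Types (x y z phi : nat -> R) (a b : nat -> nat).

Lemma sum_ltn_minn N M : (\sum_(m < N) (m < M) = minn N M)%N.
Proof.
elim: N => [|N IH]; first by rewrite big_ord0 min0n.
by rewrite big_ord_recr /= IH; case: ltnP => /=; lia.
Qed.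

Lemma sum_unique n (P : pred nat) : (forall i j, P i -> P j -> i = j) ->
  \sum_(i < n) (P i)%:R <= 1 :> R.
Proof.
move=> uP; elim: n => [|n IH]; first by rewrite big_ord0.
rewrite big_ord_recr /=; have [Pn|_] := boolP (P n); last by rewrite addr0.
rewrite big1 ?add0r// => i _; have [Pi|//] := boolP (P i).
by have := ltn_ord i; rewrite (uP _ _ Pi Pn) ltnn.
Qed.

(** The vectors before [y j] live below [b j]. By the last condition, a functional long enough to
    exploit the limited flatness of [y j] has a weight that dwarfs all those supports. *)
Definition rapidly_increasing (eps : R) (y : nat -> nat -> R) b (k : nat -> nat) :=
  [/\ forall j, (b j < b j.+1)%N, forall j, supported (b j) (b j.+1) (y j),
      forall j, flat (k j) (y j) & forall j, (b j)%:R <= eps * weight (k j)].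

Lemma homo_ltS b : (forall j, (b j < b j.+1)%N) -> nondecreasing b.
Proof.
by move=> bb; apply: homo_leq => [//|i j k|i]; [exact: leq_trans | exact: ltnW].
Qed.

Lemma norming_join_le l a (f : nat -> nat -> R) j : nondecreasing a ->
  (forall i, norming (f i)) ->
  (\sum_(i < l) segment (a i) (a i.+1) (f i) j) / weight l <= (weight l)^-1.
Proof.
move=> nda nf; have w0 := weight_gt0 l.
rewrite ler_piMl// ?invr_ge0 ?(ltW w0)//.
apply: le_trans (count_segment l j nda); apply: ler_sum => i _.
by rewrite segmentE ler_piMr//; have /andP[] := norming_bound (nf i) j.
Qed.

(* A functional of length [l] is small on every [y j] but one: on the later ones because
   they are flat, on the earlier ones because their supports are short compared to
   [weight l]. *)
Lemma long_norming_bound eps (y : nat -> nat -> R) b k n l a (f : nat -> nat -> R) N (F : pred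
  nat) :
  0 < eps -> rapidly_increasing eps y b k -> (1 < l)%N -> 2 <= eps * weight l ->
  nondecreasing a -> (forall i, norming (f i)) ->
  \sum_(j < n | F j) pairing N (fun m =>
      (\sum_(i < l) segment (a i) (a i.+1) (f i) m) / weight l) (y j) <=
  1 + eps * \sum_(j < n | F j) 1.
Proof.
move=> eps0 [bb sy fy kb] l1 Ll nda nf; have w0 := weight_gt0 l.
have njoin := norming_join l1 nda nf.
(* The exceptional indices, where neither reason for smallness applies. If [i < j] were both
   exceptional, then [b i.+1 <= b j <= eps * weight (k j) <= eps * weight l < b i.+1]. *)
pose exc j : bool := (k j < l)%N && (eps * weight l < (b j.+1)%:R).
have ndb := homo_ltS bb.
have exc_lt i j : exc i -> exc j -> (i < j)%N -> False.
  move=> /andP[_ ei] /andP[ej _] ij.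
  have : (b i.+1)%:R < (b i.+1)%:R :> R.
    apply: le_lt_trans ei; apply: (@le_trans _ _ (b j)%:R); first by rewrite ler_nat ndb.
    apply: le_trans (kb j) _; rewrite ler_pM2l//; exact/weight_le/ltnW.
  by rewrite ltxx.
have exc_le1 : \sum_(j < n) (exc j)%:R <= 1 :> R.
  apply: sum_unique => i j ei ej; case: (ltngtP i j) => // h.
    by case: (exc_lt _ _ ei ej h).
  by case: (exc_lt _ _ ej ei h).
apply: (@le_trans _ _ (\sum_(j < n | F j) ((exc j)%:R + eps))); last first.
  rewrite big_split /= mulr_sumr lerD//; last by apply: ler_sum => j _; rewrite mulr1.
  apply: le_trans exc_le1; rewrite [leRHS](bigID (fun j : 'I_n => F j))/= lerDl.
  exact: sumr_ge0.
apply: ler_sum => j _; have [ej|nej] := boolP (exc j).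
  by rewrite (le_trans ((fy j).1.2 _ N njoin))// lerDl ltW.
rewrite add0r; move: nej; rewrite negb_and -leqNgt -leNgt => /orP[lk|bl].
  have [t [ht st]] := (fy j).2 l lk a nda.
  rewrite pairing_join ler_pdivrMr//.
  by apply: le_trans Ll; apply: le_trans st; apply: ler_sum => i _; exact: (ht i).2.
apply: (@le_trans _ _ (\sum_(m < N) (weight l)^-1 * (m < b j.+1)%N%:R)).
  apply: ler_sum => m _; apply: ler_pM.
  - by have /andP[] := norming_bound njoin m.
  - exact: (fy j).1.1.
  - exact: norming_join_le.
  - have [h|h] := boolP (m < b j.+1)%N; first exact: snorm_le_coord (fy j).1.
    by rewrite (sy j m)//; lia.
rewrite -mulr_sumr mulrC ler_pdivrMr//; apply: le_trans bl.
rewrite -natr_sum ler_nat; move: (b j.+1) => M.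
by rewrite sum_ltn_minn geq_minr.
Qed.

(* Induction on the depth [d] to which the tree of a norming functional is explored;
   short functionals cut only boundedly many of the [y j]. *)
Lemma rapidly_increasing_average (eps : R) L : 0 < eps -> (1 < L)%N -> 2 <= eps * weight L ->
  forall d, exists C : R, 0 <= C /\
  forall (y : nat -> nat -> R) b k, rapidly_increasing eps y b k ->
  forall n (F : pred nat) phi N, norming phi ->
    \sum_(j < n | F j) pairing N phi (y j) <= C + (eps + 2^-1 ^+ d) * \sum_(j < n | F j) 1.
Proof.
move=> eps0 L1 hL; elim=> [|d [C [C0 IH]]].
  exists 0; split=> // y b k [_ _ fy _] n F phi N nphi; rewrite add0r mulr_sumr.
  apply: ler_sum => j _; rewrite mulr1 (le_trans ((fy j).1.2 _ N nphi))// expr0 lerDr ltW//.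
have LR : 0 <= L%:R :> R by exact: ler0n.
(* The 1 pays for coordinate functionals and long ones, [L * C] for the induction hypothesis on
   fewer than [L] pieces, and the last [L] for the vectors that contain a cut point. *)
exists (1 + L%:R * C + L%:R); split; first by rewrite !addr_ge0 ?ler01 ?mulr_ge0.
move=> y b k ris n F phi N; have [bb sy fy kb] := ris; have ndb := homo_ltS bb.
have e0 : 0 <= eps + 2^-1 ^+ d.+1 by rewrite addr_ge0 ?exprn_ge0 ?invr_ge0 ?ler0n ?(ltW eps0).
have S0 (G : pred nat) : 0 <= \sum_(j < n | G j) 1 :> R by exact: sumr_ge0.
case=> [i|l a f l1 nda nf].
  apply: (@le_trans _ _ 1); last first.
    have := mulr_ge0 e0 (S0 F); have := mulr_ge0 LR C0; lra.
  apply: le_trans (count_segment n i ndb).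
  rewrite [leRHS](bigID (fun j : 'I_n => F j))/= -[leLHS]addr0; apply: lerD; last exact: sumr_ge0.
  apply: ler_sum => j _; have [h|h] := boolP (_ <= _ < _)%N.
    exact: (fy j).1.2 _ N (norming_coord i).
  rewrite /pairing big1// => m _; have [->|] := eqVneq (m : nat) i; last by rewrite mul0r.
  by rewrite (sy j i h) mulr0.
have [Ll|lL] := leqP L l.
  have h : 2 <= eps * weight l.
    apply: le_trans hL _; rewrite ler_pM2l//; exact: weight_le.
  apply: le_trans (long_norming_bound n N F eps0 ris l1 h nda nf) _.
  have d0 : 0 <= 2^-1 ^+ d.+1 :> R by rewrite exprn_ge0 ?invr_ge0 ?ler0n.
  have := mulr_ge0 LR C0; have := mulr_ge0 d0 (S0 F).
  rewrite [(eps + _) * _]mulrDl; lra.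
(* A vector that no cut point splits is inside one segment or misses them all. Division by
   [weight l], which is at least 2, then halves the error at each depth. *)
pose inside i j : bool := (a i <= b j)%N && (b j.+1 <= a i.+1)%N.
have njoin := norming_join l1 nda nf.
have key j : pairing N (fun m => (\sum_(i < l) segment (a i) (a i.+1) (f i) m) / weight l) (y j) <=
    2^-1 * \sum_(i < l | inside i j) pairing N (f i) (y j) +
    \sum_(i < l.+1) (b j < a i < b j.+1)%N%:R.
  have p0 i : 0 <= pairing N (f i) (y j).
    apply: sumr_ge0 => m _; rewrite mulr_ge0 ?(fy j).1.1//.
    by have /andP[] := norming_bound (nf i) m.
  have [/existsP[i hi]|/existsPn nocut] := boolP [exists i : 'I_l.+1, (b j < a i < b j.+1)%N].
    apply: (@le_trans _ _ 1); first exact: (fy j).1.2 _ N njoin.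
    rewrite (bigD1 i)//= hi [_ + (_ + _)]addrCA lerDl addr_ge0 ?sumr_ge0//.
    by rewrite mulr_ge0 ?invr_ge0 ?sumr_ge0.
  rewrite pairing_join mulrC -[leLHS]addr0; apply: lerD; last exact: sumr_ge0.
  have E : \sum_(i < l) pairing N (f i) (segment (a i) (a i.+1) (y j)) <=
      \sum_(i < l | inside i j) pairing N (f i) (y j).
    rewrite [leLHS](bigID (fun i : 'I_l => inside i j))/= -[leRHS]addr0; apply: lerD.
      apply: ler_sum => i /andP[h1 h2]; rewrite segment_id// => m hm.
      by apply: sy; lia.
    rewrite big1// => i ni; rewrite /pairing big1// => m _.
    have := nocut (inord i); have := nocut (inord i.+1).
    have h := ltn_ord i; rewrite !inordK; [|lia|lia] => c1 c2.
    rewrite segmentE; have [hm|] := boolP (a i <= m < a i.+1)%N; last by rewrite mul0r mulr0.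
    by rewrite (sy j m) ?mulr0//; have := bb j; move: ni; rewrite /inside; lia.
  apply: ler_pM => //; first by rewrite invr_ge0 ltW// weight_gt0.
    by apply: sumr_ge0 => i _; apply: sumr_ge0 => m _;
      rewrite mulr_ge0 ?segment_ge0// ?(fy j).1.1//;
      [have /andP[] := norming_bound (nf i) m | exact: (fy j).1.1].
  by rewrite lef_pV2 ?weight_ge2// posrE// weight_gt0.
apply: le_trans; first by apply: ler_sum => j _; exact: key.
rewrite big_split /= -mulr_sumr.
have A : \sum_(j < n | F j) \sum_(i < l | inside i j) pairing N (f i) (y j) <=
    l%:R * C + (eps + 2^-1 ^+ d) * \sum_(j < n | F j) 1.
  rewrite (exchange_big_dep predT)//=.
  apply: (@le_trans _ _ (\sum_(i < l) (C + (eps + 2^-1 ^+ d) * \sum_(j < n | F j && inside i j)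
    1))).
    by apply: ler_sum => i _; exact: (IH _ _ _ ris n (fun j => F j && inside i j)).
  rewrite big_split /= sumr_const card_ord -[C *+ l]mulr_natl lerD2l -mulr_sumr.
  apply: ler_wpM2l; first by rewrite addr_ge0 ?exprn_ge0 ?invr_ge0 ?ler0n ?(ltW eps0).
  (* Each [y j] is inside at most one segment, so the error terms of the [l] subproblems add up to
     no more than that of [F]. *)
  rewrite (eq_bigr (fun i : 'I_l => \sum_(j < n | F j) if inside i j then 1 else 0));
    last by move=> i _; exact: big_mkcondr.
  rewrite exchange_big /=; apply: ler_sum => j _.
  rewrite (eq_bigr (fun i : 'I_l => (inside i j)%:R)); last by move=> i _; case: ifP.
  apply: (@sum_unique l (fun i => inside i j)) => i i' /andP[h1 h2] /andP[h3 h4].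
  have := bb j; case: (ltngtP i i') => // h; have := nda _ _ h; lia.
have D : \sum_(j < n | F j) \sum_(i < l.+1) (b j < a i < b j.+1)%N%:R <= L%:R :> R.
  rewrite exchange_big /=; apply: (@le_trans _ _ (\sum_(i < l.+1) 1));
    last by rewrite sumr_const card_ord ler_nat.
  apply: ler_sum => i _; apply: le_trans (count_segment n (a i) ndb).
  rewrite [leRHS](bigID (fun j : 'I_n => F j))/= -[leLHS]addr0; apply: lerD; last exact: sumr_ge0.
  by apply: ler_sum => j _; rewrite ler_nat; case: leqP; case: ltnP => //=; case: ltnP => //=; lia.
have lC : l%:R * C <= L%:R * C by rewrite ler_wpM2r// ler_nat ltnW.
have LC : 0 <= L%:R * C by rewrite mulr_ge0.
have := mulr_ge0 (ltW eps0) (S0 F).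
rewrite exprS; move: A D lC LC; rewrite !mulrDl -[2^-1 * _ * _]mulrA; lra.
Qed.

End RapidlyIncreasing.

(** * Entropy maximization over the unit ball *)

Section Entropy.
Variable R : realType.
Implicit Types (h x y z phi : nat -> R) (a b : nat -> nat).

Lemma ln_leB1 (v : R) : 0 < v -> ln v <= v - 1.
Proof.
by move=> v0; have := @le_ln1Dx R (v - 1); rewrite subrKC; apply; lra.
Qed.

(** The tangent to [ln] at [c^-1]; the free slope lets it stand in for Jensen's inequality. *)
Lemma ln_le_affine (c v : R) : 0 < c -> 0 < v -> ln v <= c * v - 1 - ln c.
Proof.
by move=> c0 v0; have := ln_leB1 (mulr_gt0 c0 v0); rewrite lnM ?posrE//; lra.
Qed.

Lemma ln1D_ge (u : R) : - 2^-1 <= u -> u - 2 * u ^+ 2 <= ln (1 + u).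
Proof.
move=> hu; have u1 : 0 < 1 + u by lra.
have v0 : 0 < (1 + u)^-1 by rewrite invr_gt0.
have := ln_leB1 v0; rewrite lnV ?posrE// => h.
suff : (1 + u)^-1 <= 1 - u + 2 * u ^+ 2 by lra.
rewrite -[leLHS]mul1r ler_pdivrMr// -subr_ge0.
have -> : (1 - u + 2 * u ^+ 2) * (1 + u) - 1 = u ^+ 2 * (1 + 2 * u) by ring.
by rewrite mulr_ge0 ?sqr_ge0//; lra.
Qed.

(** The tangent of slope 4 gives [r - 1 - ln r >= ln 4 - 3 * r], and [ln 4 >= 1]. *)
Lemma ln_ratio_gap (r : R) : 0 < r -> r < 4^-1 -> 4^-1 <= r - 1 - ln r.
Proof.
move=> r0 r4; have h := @ln_le_affine 4 r ltac:(lra) r0.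
have : 1 <= ln 4 :> R.
  have e : 4 = 2^-1^-1 * 2^-1^-1 :> R by rewrite invrK; ring.
  rewrite e lnM ?posrE ?invrK ?ltr0n//.
  have := @ln_leB1 2^-1 ltac:(lra); rewrite lnV ?posrE ?ltr0n//; lra.
lra.
Qed.

Definition entropy N h x : R := \sum_(i < N) h i * ln (x i).

Definition probability N h :=
  [/\ forall j, 0 <= h j, supported 0 N h & \sum_(i < N) h i = 1].

(** Positivity is imposed because [ln] is 0 at 0 here: a coordinate of [x] vanishing where [h] does
    not would go unpunished. *)
Definition admissible h x := snorm_le x 1 /\ forall i, 0 < h i -> 0 < x i.

Definition max_entropy N h : R :=
  sup [set r : R | exists2 x, admissible h x & r = entropy N h x].

Lemma entropy_le0 N h x : (forall j, 0 <= h j) -> snorm_le x 1 -> entropy N h x <= 0.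
Proof.
move=> h0 x1; apply: sumr_le0 => i _; rewrite mulr_ge0_le0// ln_le0//.
exact: snorm_le_coord x1.
Qed.

Lemma exists_admissible N h : (0 < N)%N -> supported 0 N h -> exists x, admissible h x.
Proof.
(* The uniform vector works because norming functionals have coordinates at most 1, so the l_1 norm
   dominates that of S. *)
move=> N0 sh; exists (fun j => N%:R^-1 * (j < N)%N%:R); split; last first.
  move=> i hi; have [iN|iN] := boolP (i < N)%N; first by rewrite mulr1 invr_gt0 ltr0n.
  by move: hi; rewrite sh ?ltxx.
split=> [j|phi M nphi]; first by rewrite mulr_ge0 ?invr_ge0.
rewrite pairingZr ler_pdivrMl ?ltr0n// mulr1.
apply: (@le_trans _ _ (\sum_(m < M) (m < N)%N%:R)).
  apply: ler_sum => m _; rewrite ler_piMl//; by have /andP[] := norming_bound nphi m.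
by rewrite -natr_sum ler_nat sum_ltn_minn geq_minr.
Qed.

Lemma probability_gt0 N h : probability N h -> (0 < N)%N.
Proof. by case: N => // -[_ _]; rewrite big_ord0 => /esym/eqP; rewrite oner_eq0. Qed.

Lemma has_sup_entropy N h : probability N h ->
  has_sup [set r : R | exists2 x, admissible h x & r = entropy N h x].
Proof.
move=> ph; have [h0 sh _] := ph; have [x ax] := exists_admissible (probability_gt0 ph) sh.
split; first by exists (entropy N h x); exists x.
by exists 0 => r [z [z1 _] ->]; exact: entropy_le0.
Qed.

Lemma max_entropy_ge N h x : probability N h -> admissible h x ->
  entropy N h x <= max_entropy N h.
Proof. by move=> ph ax; apply: sup_upper_bound; [exact: has_sup_entropy|exists x]. Qed.

Lemma max_entropy_adherent N h (e : R) : probability N h -> 0 < e ->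
  exists2 x, admissible h x & max_entropy N h - e < entropy N h x.
Proof.
move=> ph e0; have [r [x ax ->] hr] := sup_adherent e0 (has_sup_entropy ph).
by exists x.
Qed.

Lemma max_entropy_le N h (c : R) : probability N h ->
  (forall x, admissible h x -> entropy N h x <= c) -> max_entropy N h <= c.
Proof.
by move=> ph hc; apply: ge_sup; [exact: (has_sup_entropy ph).1 | move=> r [x ax ->]; exact: hc].
Qed.

(* First-order optimality: moving the near-maximizer [x] towards [z] cannot increase the
   entropy by much, which says that [h / x] is almost in the dual unit ball. *)
Lemma near_maximizer N h (d : R) : probability N h -> 0 < d -> d <= 1 ->
  exists x, [/\ admissible h x, max_entropy N h - d < entropy N h x &
    forall z, snorm_le z 1 -> \sum_(i < N) h i * (z i / x i) <= 1 + d].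
Proof.
move=> ph d0 d1; have [h0 sh h1] := ph.
set M := max_entropy N h.
have M0 : M <= 0 by apply: max_entropy_le => // x [x1 _]; exact: entropy_le0.
(* A bound for the ratios [z i / x i]: as every term of the entropy is nonpositive, near-maximality
   gives [h i * ln (x i) >= M - 1], while [z i <= 1]. *)
pose S := 1 + \sum_(i < N) expR ((1 - M) / h i).
have S1 : 1 <= S by rewrite lerDl sumr_ge0// => i _; exact: expR_ge0.
have S2 : 0 < S ^+ 2 by rewrite exprn_gt0//; lra.
(* The second-order error [2 * (t * S) ^+ 2] is then [t * d / 2]. With the slack [e = t * d / 2]
   this makes [t * d], which becomes [d] after division by [t]. *)
pose t := d / (4 * S ^+ 2).
have t0 : 0 < t by rewrite divr_gt0// mulr_gt0.
have tS : t * S ^+ 2 = d / 4 by rewrite /t; field; rewrite gt_eqF//; lra.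
have t4 : t <= 4^-1.
  have : t <= t * S ^+ 2 by rewrite ler_peMr ?(ltW t0)// exprn_ege1.
  lra.
pose e := t * d / 2.
have e0 : 0 < e by rewrite divr_gt0// mulr_gt0.
have ed : e <= d by rewrite /e; nra.
have [x ax Mx] := max_entropy_adherent ph e0.
exists x; split=> //; first by apply: le_lt_trans Mx; rewrite lerD2l lerN2.
move=> z z1; have [x1 xp] := ax.
have ratio i : (i < N)%N -> 0 < h i -> 0 <= z i / x i <= S.
  move=> iN hi; have xi := xp _ hi; rewrite divr_ge0 ?z1.1 ?(ltW xi)//=.
  rewrite ler_pdivrMr//; apply: (le_trans (snorm_le_coord i z1)).
  rewrite -ler_pdivrMr// mul1r.
  apply: (@le_trans _ _ (expR ((1 - M) / h i))); last first.
    rewrite /S (bigD1 (Ordinal iN))//= addrCA lerDl addr_ge0// sumr_ge0// => j _; exact: expR_ge0.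
  rewrite -[x i]lnK ?posrE// -expRN ler_expR ler_pdivlMr// mulNr.
  have : M - 1 <= h i * ln (x i).
    apply: (@le_trans _ _ (entropy N h x));
      first by rewrite ltW// (le_lt_trans _ Mx)// lerD2l lerN2 (le_trans ed).
    rewrite /entropy (bigD1 (Ordinal iN))//= gerDl.
    apply: sumr_le0 => j _; rewrite mulr_ge0_le0// ln_le0//; exact: snorm_le_coord x1.
  rewrite mulrC; lra.
pose w j := (1 - t) * x j + t * z j.
have aw : admissible h w.
  have t1 : 0 < 1 - t by lra.
  split; last first.
    by move=> i hi; rewrite /w ltr_pwDl ?(mulr_gt0 t1 (xp _ hi))// mulr_ge0 ?z1.1// ltW.
  have wz : (1 - t) * 1 + t * 1 = 1 by ring.
  split=> [j|phi K nphi]; first by rewrite addr_ge0// mulr_ge0 ?x1.1 ?z1.1// ltW.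
  have -> : pairing K phi w = (1 - t) * pairing K phi x + t * pairing K phi z.
    rewrite /pairing !mulr_sumr -big_split; apply: eq_bigr => i _; rewrite /w /=; ring.
  by rewrite -[leRHS]wz; apply: lerD; apply: ler_wpM2l; rewrite ?x1.2 ?z1.2// ltW.
have Hw := max_entropy_ge ph aw.
have : \sum_(i < N) h i * (t * (z i / x i - 1) - 2 * (t * S) ^+ 2) <= e.
  apply: (@le_trans _ _ (entropy N h w - entropy N h x)); last by move: Mx Hw; rewrite -/M; lra.
  rewrite /entropy -sumrB; apply: ler_sum => i _; rewrite -mulrBr.
  have := h0 i; rewrite le_eqVlt => /predU1P[<-|hi]; first by rewrite !mul0r.
  apply: ler_wpM2l; first exact: ltW.
  have xi := xp _ hi; have wi := aw.2 _ hi.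
  rewrite -ln_div ?posrE//.
  have -> : w i / x i = 1 + t * (z i / x i - 1) by rewrite /w; field; rewrite gt_eqF.
  have /andP[r0 rS] := ratio i (ltn_ord i) hi.
  move: (z i / x i) r0 rS => r r0 rS.
  apply: le_trans (ln1D_ge _); last by nra.
  rewrite lerD2l lerN2 ler_pM2l// -subr_ge0.
  have -> : (t * S) ^+ 2 - (t * (r - 1)) ^+ 2 = t ^+ 2 * ((S - r + 1) * (S + r - 1)) by ring.
  by rewrite mulr_ge0 ?sqr_ge0// mulr_ge0//; lra.
have -> : \sum_(i < N) h i * (t * (z i / x i - 1) - 2 * (t * S) ^+ 2) =
    t * (\sum_(i < N) h i * (z i / x i)) - (t + 2 * (t * S) ^+ 2).
  rewrite (eq_bigr (fun i : 'I_N => t * (h i * (z i / x i)) - h i * (t + 2 * (t * S) ^+ 2))).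
    by rewrite sumrB -mulr_sumr -mulr_suml h1 mul1r.
  by move=> i _; ring.
move: (\sum_(i < N) _) => s hs.
suff : t * s <= t * (1 + d) by rewrite ler_pM2l.
have : 2 * (t * S) ^+ 2 = t * d / 2.
  have -> : 2 * (t * S) ^+ 2 = 2 * t * (t * S ^+ 2) by ring.
  by rewrite tS; field.
rewrite /e in hs; lra.
Qed.

End Entropy.

(** * Entropy of averages of successive blocks *)

Section Averages.
Variable R : realType.
Implicit Types (h x y z phi : nat -> R) (a b : nat -> nat).

Lemma sum_const_ord n (x : R) : \sum_(i < n) x = n%:R * x.
Proof. by rewrite sumr_const card_ord mulr_natl. Qed.

Lemma sum_supported s t N h : (t <= N)%N -> supported s t h ->
  \sum_(j < N) h j = \sum_(j < t) h j.
Proof.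
move=> tN sh; rewrite -!(big_mkord predT) (big_cat_nat _ tN)//=.
rewrite [X in _ + X]big_nat_cond [X in _ + X]big1 ?addr0// => j /andP[/andP[tj _] _].
by rewrite sh//; lia.
Qed.

Lemma supported_sub s t s' t' h : (s' <= s)%N -> (t <= t')%N ->
  supported s t h -> supported s' t' h.
Proof. by move=> ss tt sh j hj; apply: sh; lia. Qed.

Lemma sum_window s t N (F : nat -> R) : (s <= t)%N -> (t <= N)%N ->
  \sum_(i < N) (s <= i < t)%N%:R * F i = \sum_(j < t - s) F (s + j)%N.
Proof.
move=> st tN; rewrite -(big_mkord predT (fun i => (s <= i < t)%N%:R * F i)).
rewrite (big_cat_nat _ tN)//= (big_cat_nat _ st)//=.
rewrite big_nat_cond big1 ?add0r; last by move=> i /andP[/andP[_ is_] _];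
  rewrite (_ : (_ <= i < _)%N = false) ?mul0r//; lia.
rewrite [X in _ + X]big_nat_cond [X in _ + X]big1 ?addr0; last by move=> i /andP[/andP[ti _] _];
  rewrite (_ : (_ <= i < _)%N = false) ?mul0r//; lia.
rewrite -{1}[s]add0n big_addn big_mkord; apply: eq_bigr => j _.
by rewrite (_ : (_ <= _ < _)%N = true) ?mul1r 1?addnC//; have := ltn_ord j; lia.
Qed.

Definition block_average n (g : nat -> R) m : R := n%:R^-1 * \sum_(j < n) g (m * n + j)%N.

Lemma iter_block_average n s g m :
  iter s (block_average n) g m = (n ^ s)%:R^-1 * \sum_(j < n ^ s) g (m * n ^ s + j)%N.
Proof.
elim: s m => [|s IH] m; first by rewrite expn0 invr1 mul1r big_ord1 muln1 addn0.
rewrite iterS /block_average expnS natrM invfM -mulrA; congr (_ * _).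
rewrite -(big_mkord predT (fun j => g (m * (n * n ^ s) + j)%N)) big_nat_mul big_mkord mulr_sumr.
apply: eq_bigr => i _; rewrite IH; congr (_ * _).
rewrite -{1}[(i * n ^ s)%N]add0n big_addn mulSn addnK big_mkord.
by apply: eq_bigr => j _; congr g; lia.
Qed.

Lemma iter_block_average_window n s g m N : (m.+1 * n ^ s <= N)%N ->
  iter s (block_average n) g m =
  \sum_(i < N) ((n ^ s)%:R^-1 * (m * n ^ s <= i < m.+1 * n ^ s)%N%:R) * g i.
Proof.
move=> hN; rewrite iter_block_average; under [RHS]eq_bigr do rewrite -mulrA.
rewrite -mulr_sumr; congr (_ * _); rewrite sum_window//; last by lia.
by rewrite mulSn addnK.
Qed.

Lemma probability_average N n (q : nat -> nat -> R) : (0 < n)%N ->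
  (forall i, (i < n)%N -> probability N (q i)) ->
  probability N (fun j => n%:R^-1 * \sum_(i < n) q i j).
Proof.
move=> n0 pq; split=> [j|j hj|].
- by rewrite mulr_ge0 ?invr_ge0// sumr_ge0// => i _; have [] := pq i (ltn_ord i).
- by rewrite big1 ?mulr0// => i _; have [_ h _] := pq i (ltn_ord i); exact: h.
- rewrite -mulr_sumr exchange_big /= (eq_bigr (fun=> 1)).
    by rewrite sumr_const card_ord mulVf// pnatr_eq0 -lt0n.
  by move=> i _; have [] := pq i (ltn_ord i).
Qed.

Lemma entropy_average N n (q : nat -> nat -> R) x :
  entropy N (fun j => n%:R^-1 * \sum_(i < n) q i j) x =
  n%:R^-1 * \sum_(i < n) entropy N (q i) x.
Proof.
rewrite /entropy exchange_big /= mulr_sumr; apply: eq_bigr => j _.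
by rewrite -mulrA mulr_suml.
Qed.

Lemma admissible_average n (q : nat -> nat -> R) x : (0 < n)%N ->
  (forall i j, (i < n)%N -> 0 <= q i j) ->
  admissible (fun j => n%:R^-1 * \sum_(i < n) q i j) x ->
  forall i, (i < n)%N -> admissible (q i) x.
Proof.
move=> n0 q0 [x1 xp] i iN; split=> // j qij; apply: xp.
rewrite mulr_gt0 ?invr_gt0 ?ltr0n// (bigD1 (Ordinal iN))//= ltr_pwDl// sumr_ge0// => k _.
exact: q0.
Qed.

Lemma probability_exists_gt0 N h : probability N h -> exists2 j, (j < N)%N & 0 < h j.
Proof.
case=> h0 _ h1; apply/not_exists2P => H.
have : \sum_(i < N) h i = 0.
  apply: big1 => i _; apply/eqP; rewrite eq_le h0 andbT leNgt; apply/negP => hi.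
  by have [/(_ (ltn_ord i))|] := H i.
by rewrite h1 => /eqP; rewrite oner_eq0.
Qed.

Lemma entropy_segment N h x s t : supported s t h ->
  entropy N h (segment s t x) = entropy N h x.
Proof.
move=> sh; apply: eq_bigr => i _; rewrite segmentE.
by have [|/sh ->] := boolP (s <= i < t)%N; rewrite ?mul1r ?mul0r.
Qed.

Lemma entropyZ N h x (c : R) : probability N h -> 0 < c ->
  (forall i, 0 < h i -> 0 < x i) ->
  entropy N h (fun j => c * x j) = entropy N h x + ln c.
Proof.
move=> [h0 _ h1] c0 xp; rewrite -[ln c]mul1r -h1 mulr_suml -big_split /=.
apply: eq_bigr => i _; have := h0 i; rewrite le_eqVlt => /predU1P[<-|hi].
  by rewrite !mul0r addr0.
by rewrite lnM ?posrE ?xp//; ring.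
Qed.

(** Cut [x] into pieces of norms [t i] with sum at most [weight l]. A normalized piece competes for
    the maximum of [q i], at the price [ln (t i)]; by concavity these prices average to at most
    [ln (weight l / l)]. *)
Lemma max_entropy_average N l a (q : nat -> nat -> R) : (1 < l)%N -> nondecreasing a ->
  (forall i, (i < l)%N -> probability N (q i)) ->
  (forall i, (i < l)%N -> supported (a i) (a i.+1) (q i)) ->
  max_entropy N (fun j => l%:R^-1 * \sum_(i < l) q i j) <=
  l%:R^-1 * \sum_(i < l) max_entropy N (q i) + (ln (weight l) - ln l%:R).
Proof.
move=> l1 nda pq sq; have l0 : (0 < l)%N by lia.
have l0R : 0 < l%:R :> R by rewrite ltr0n.
have w0 : 0 < weight l :> R := weight_gt0 l.
apply: max_entropy_le; first exact: probability_average.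
move=> x ax; rewrite entropy_average.
have aq : forall i, (i < l)%N -> admissible (q i) x.
  by apply: admissible_average => // i j il; have [] := pq i il.
have [t [ht st]] := snorm_le_split l1 ax.1 nda.
(* The slope of the tangent to [ln] at [weight l / l], which bounds the mean of the [t i]. *)
pose c := l%:R / weight l : R.
have c0 : 0 < c by rewrite divr_gt0.
have key i : (i < l)%N -> entropy N (q i) x <= max_entropy N (q i) + (c * t i - 1 - ln c).
  move=> il; have [j _ qj] := probability_exists_gt0 (pq i il).
  have inj : (a i <= j < a i.+1)%N.
    by apply/negPn/negP => /(sq i il) e; rewrite e ltxx in qj.
  have t0 : 0 < t i.
    apply: lt_le_trans (snorm_le_coord j (ht i)); rewrite segmentE inj mul1r.
    exact: (aq i il).2.
  have sp k : 0 < q i k -> 0 < segment (a i) (a i.+1) x k.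
    move=> qk; rewrite segmentE; have [_|/(sq i il) e] := boolP (a i <= k < a i.+1)%N.
      by rewrite mul1r (aq i il).2.
    by rewrite e ltxx in qk.
  have := @max_entropy_ge _ N (q i) (fun k => (t i)^-1 * segment (a i) (a i.+1) x k) (pq i il).
  rewrite entropyZ ?invr_gt0//; last exact: pq.
  rewrite entropy_segment ?lnV ?posrE//; last exact: sq.
  have := ln_le_affine c0 t0 => h1 h2.
  suff : entropy N (q i) x - ln (t i) <= max_entropy N (q i) by lra.
  apply: h2; split=> [|k qk]; last by rewrite mulr_gt0 ?invr_gt0 ?sp.
  have -> : 1 = (t i)^-1 * t i by rewrite mulVf// gt_eqF.
  apply: snorm_leZ; [by rewrite invr_ge0 ltW | exact: ht].
apply: (@le_trans _ _ (l%:R^-1 * \sum_(i < l) (max_entropy N (q i) + (c * t i - 1 - ln c)))).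
  apply: ler_wpM2l; first by rewrite invr_ge0 ltW.
  by apply: ler_sum => i _; exact: key.
rewrite big_split mulrDr /= lerD2l ler_pdivrMl// !sumrB -mulr_sumr !sum_const_ord.
rewrite /c ln_div ?posrE//.
rewrite (_ : _ * (ln l%:R - _) = - (l%:R * (ln (weight l) - ln l%:R))); last by ring.
rewrite opprK gerDr subr_le0 -mulrA ler_pM2l// ler_pdivrMl// mulr1//.
Qed.

Definition block_probabilities a (P : nat -> nat -> R) :=
  [/\ forall i, (a i < a i.+1)%N, forall i j, 0 <= P i j,
      forall i, supported (a i) (a i.+1) (P i) &
      forall i, \sum_(j < a i.+1) P i j = 1].

Definition convex_weights n (c : nat -> R) := (forall i, 0 <= c i) /\ \sum_(i < n) c i = 1.

Lemma weight_exp_le n r : weight (n ^ r) <= (r * n).+1%:R :> R.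
Proof.
rewrite /weight ler_nat ltnS; have [n0|n0] := posnP (n ^ r)%N; first by rewrite n0 trunc_log0.
rewrite -(leq_exp2l (m := 2))//; apply: leq_trans (trunc_logP _ n0) _ => //.
rewrite mulnC expnM; case: (posnP r) => [->//|r0].
by rewrite leq_exp2r// ltnW// ltn_expl.
Qed.

End Averages.

(** * A level at which the maximal entropy is almost additive *)

Section AdditiveLevel.
Variable R : realType.
Implicit Types (h x y z phi : nat -> R) (a b : nat -> nat).

Lemma ltn_window s t n m : (0 < n)%N -> (s <= t)%N -> (m < n ^ (t - s))%N ->
  (m.+1 * n ^ s <= n ^ t)%N.
Proof.
by move=> n0 st mn; rewrite -{1}(subnK st) expnD leq_mul2r mn orbT.
Qed.

Lemma block_probability a (P : nat -> nat -> R) I i :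
  block_probabilities a P -> (i < I)%N -> probability (a I) (P i).
Proof.
move=> [aa P0 sP P1] iI; have ndI : (a i.+1 <= a I)%N by apply: homo_ltS.
split=> //; first exact: supported_sub (sP i).
by rewrite (sum_supported ndI (sP i)).
Qed.

Lemma exists_small_log_weight n (e : R) : (0 < n)%N -> 0 < e ->
  exists r, (0 < r)%N /\ ln (weight (n ^ r)) < r%:R * e.
Proof.
(* With this slope the tangent bound on [ln (r * n).+1] is [r * e / 2] plus the constant
   [c - 1 - ln c], and [r > M] makes that constant smaller than [r * e / 2]. *)
move=> n0 e0; pose c : R := e / (2 * n%:R).
have n0R : 0 < n%:R :> R by rewrite ltr0n.
have c0 : 0 < c by rewrite divr_gt0// mulr_gt0.
pose M := 2 * (c - 1 - ln c) / e.
exists (Num.truncn `|M|).+1; split=> //; set r := (Num.truncn _).+1.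
have Mr : M < r%:R by rewrite (le_lt_trans (ler_norm _))// truncnS_gt.
apply: (@le_lt_trans _ _ (ln (r * n).+1%:R)).
  by rewrite ler_ln ?posrE ?weight_gt0 ?ltr0n// weight_exp_le.
apply: le_lt_trans (ln_le_affine c0 _) _; first by rewrite ltr0n.
rewrite -natr1 natrM mulrDr mulr1.
have -> : c * (r%:R * n%:R) = r%:R * e / 2 by rewrite /c; field; rewrite gt_eqF.
by move: Mr; rewrite /M ltr_pdivrMr//; lra.
Qed.

(* The maximal entropy drops by at most [ln (n ^ r)] - [ln (weight (n ^ r))] over
   [r] successive averagings; were every averaging to lose [e] less than the
   trivial [ln n], the total loss would be too small, as [ln (weight (n ^ r))] is
   only logarithmic in [r]. *)
Lemma exists_additive_level a (P : nat -> nat -> R) n (e : R) :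
  block_probabilities a P -> (1 < n)%N -> 0 < e ->
  exists I q b c, [/\ nondecreasing b,
    forall j, (j < n)%N -> probability (a I) (q j) /\ supported (b j) (b j.+1) (q j),
    convex_weights I c,
    forall t, n%:R^-1 * \sum_(j < n) q j t = \sum_(i < I) c i * P i t &
    max_entropy (a I) (fun t => n%:R^-1 * \sum_(j < n) q j t) <=
      n%:R^-1 * \sum_(j < n) max_entropy (a I) (q j) - ln n%:R + e].
Proof.
move=> bP n1 e0; have [aa P0 sP P1] := bP; have nda := homo_ltS aa.
have n0 : (0 < n)%N by lia.
have n0R : 0 < n%:R :> R by rewrite ltr0n.
have [r [r0 hr]] := exists_small_log_weight n0 e0.
pose I := (n ^ r)%N; pose N := a I.
pose Q s m t := iter s (block_average n) (fun i => P i t) m.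
have QE s m t : (m.+1 * n ^ s <= I)%N -> Q s m t =
    \sum_(i < I) ((n ^ s)%:R^-1 * (m * n ^ s <= i < m.+1 * n ^ s)%N%:R) * P i t.
  exact: iter_block_average_window.
have ns0 s : 0 < (n ^ s)%:R :> R by rewrite ltr0n expn_gt0 n0.
have cw s m : (m.+1 * n ^ s <= I)%N ->
    convex_weights I (fun i => (n ^ s)%:R^-1 * (m * n ^ s <= i < m.+1 * n ^ s)%N%:R : R).
  move=> hm; split=> [i|]; first by rewrite mulr_ge0 ?ler0n ?invr_ge0 ?ler0n.
  have h : (m * n ^ s <= m.+1 * n ^ s)%N by rewrite leq_mul2r leqnSn orbT.
  rewrite -mulr_sumr; have := @sum_window R _ _ _ (fun=> 1) h hm.
  under eq_bigr do rewrite mulr1.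
  by move=> ->; rewrite mulSn addnK sumr_const card_ord mulVf// gt_eqF.
have pQ s m : (m.+1 * n ^ s <= I)%N -> probability N (Q s m).
  move=> hm; have [c0 c1] := cw s m hm; split=> [t|t ht|].
  - by rewrite QE// sumr_ge0// => i _; rewrite mulr_ge0 ?c0.
  - rewrite QE// big1// => i _; have [_ -> //] := block_probability bP (ltn_ord i).
    by rewrite mulr0.
  - under eq_bigr do rewrite QE//.
    rewrite exchange_big /= -[RHS]c1; apply: eq_bigr => i _.
    by rewrite -mulr_sumr; have [_ _ ->] := block_probability bP (ltn_ord i); rewrite mulr1.
have sQ s m : (m.+1 * n ^ s <= I)%N -> supported (a (m * n ^ s)%N) (a (m.+1 * n ^ s)%N) (Q s m).
  move=> hm t ht; rewrite QE// big1// => i _.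
  have [hi|] := boolP (m * n ^ s <= i < m.+1 * n ^ s)%N; last by rewrite mulr0 mul0r.
  rewrite sP ?mulr0//; move/andP: hi => [h1 h2].
  by have := nda _ _ h1; have := nda _ _ h2; lia.
apply/not_existsP => H.
pose E i := max_entropy N (P i).
(* If no level is almost additive, each averaging gains [e] over the loss [ln n]; here [m] numbers
   the blocks of length [n ^ s]. *)
have claim s m : (s <= r)%N -> (m < n ^ (r - s))%N ->
    iter s (block_average n) E m - s%:R * ln n%:R + s%:R * e <= max_entropy N (Q s m).
  elim: s m => [|s IH] m sr hm.
    by rewrite !mul0r subr0 addr0.
  have hin j : (j < n)%N -> (m * n + j < n ^ (r - s))%N.
    move=> jn; rewrite (_ : (r - s = (r - s.+1).+1)%N) ?expnS; last by lia.
    apply: (@leq_trans (m.+1 * n)%N); first by rewrite mulSn; lia.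
    by rewrite [leqRHS]mulnC leq_mul2r hm orbT.
  have hw j : (j < n)%N -> ((m * n + j).+1 * n ^ s <= I)%N.
    by move=> jn; apply: ltn_window => //; [exact: ltnW | exact: hin].
  have hS : (m.+1 * n ^ s.+1 <= I)%N by exact: ltn_window.
  have : ~ (max_entropy N (Q s.+1 m) <=
      n%:R^-1 * \sum_(j < n) max_entropy N (Q s (m * n + j)%N) - ln n%:R + e).
    move=> h; apply: (H I); exists (fun j => Q s (m * n + j)%N), (fun j =>
      a ((m * n + j) * n ^ s)%N).
    exists (fun i => (n ^ s.+1)%:R^-1 * (m * n ^ s.+1 <= i < m.+1 * n ^ s.+1)%N%:R); split.
    - by move=> i j ij; apply: nda; rewrite leq_mul2r leq_add2l ij orbT.
    - by move=> j jn; split; [apply/pQ/hw | rewrite addnS; apply/sQ/hw].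
    - exact: cw.
    - by move=> t; rewrite -(QE s.+1 m t hS).
    - exact: h.
  move=> /negP; rewrite -ltNge => h.
  apply: le_trans (ltW h); rewrite iterS {1}/block_average.
  have : n%:R^-1 * \sum_(j < n) (iter s (block_average n) E (m * n + j)%N - s%:R * ln n%:R + s%:R
    * e) <=
      n%:R^-1 * \sum_(j < n) max_entropy N (Q s (m * n + j)%N).
    apply: ler_wpM2l; first by rewrite invr_ge0 ltW.
    by apply: ler_sum => j _; apply: IH; [exact: ltnW | exact: hin].
  rewrite !big_split /= !sum_const_ord !mulrDr !mulKf ?gt_eqF//.
  rewrite -natr1; lra.
have := claim r 0 (leqnn r); rewrite subnn expn0 => /(_ isT).
have I1 : (1 < I)%N by rewrite /I -(exp1n r) ltn_exp2r.
rewrite iter_block_average (_ : \sum_(j < _) _ = \sum_(j < I) E j)//.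
have -> : Q r 0%N = (fun t => I%:R^-1 * \sum_(j < I) P j t).
  by apply/funext => t; rewrite /Q iter_block_average.
(* Averaging all [n ^ r] blocks at once loses at least [r * ln n - ln (weight (n ^ r))]. Against
   [claim] this forces [r * e <= ln (weight (n ^ r))], contrary to the choice of [r]. *)
have := max_entropy_average I1 nda (fun i => @block_probability a P I i bP) (fun i _ => sP i).
rewrite -/N -/I -/E natrX lnXn// -[ln _ *+ _]mulr_natl.
lra.
Qed.

End AdditiveLevel.

(** * Approximate Lozanovskii factorization through flat vectors *)

Section Factorization.
Variable R : realType.
Implicit Types (h x y z phi : nat -> R) (a b : nat -> nat).

(** Twice the dual unit ball, since a near-maximizer [x] only puts [h / x] in [1 + d] times that
    ball. *)
Definition dual_le2 phi := (forall j, 0 <= phi j) /\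
  forall z, snorm_le z 1 -> forall N, pairing N phi z <= 2.

(** The identity [h = phi y] is relaxed twice: by a factor 4, and on a set of [h]-mass [e]. *)
Definition factors s t k (e : R) h y phi :=
  [/\ flat k y, dual_le2 phi, supported s t y, supported s t phi &
      \sum_(j < t | 4 * (phi j * y j) < h j) h j <= e].

Lemma flat_mono k x y : (forall j, 0 <= x j <= y j) -> flat k y -> flat k x.
Proof.
move=> xy [y1 fy]; split=> [|l lk a nda]; first exact: snorm_le_mono y1.
have [t [ht st]] := fy l lk a nda; exists t; split=> // i.
by apply: snorm_le_mono (ht i) => j; rewrite !segmentE; case: (_ <= _ < _)%N;
  rewrite ?mul1r ?mul0r ?lexx.
Qed.

Lemma flat_leq k k' y : (k <= k')%N -> flat k' y -> flat k y.
Proof. by move=> kk [y1 fy]; split=> // l lk; apply: fy; lia. Qed.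

Lemma pairing_supported_le M N phi x : supported 0 N phi ->
  (forall j, 0 <= phi j) -> (forall j, 0 <= x j) -> pairing M phi x <= pairing N phi x.
Proof.
move=> sp p0 x0; apply: le_trans (pairing_mono (leq_maxl M N) p0 x0) _.
rewrite /pairing (@sum_supported _ 0 N (maxn M N) (fun i => phi i * x i)) ?leq_maxr//.
by move=> j /sp ->; rewrite mul0r.
Qed.

(* If [y] is almost as good as the maximizer [x], then [r = y / x] satisfies
   [sum h (r - 1 - ln r)] small, hence [r >= 1/4] on most of the mass of [h]. *)
Lemma exists_factors0 a (P : nat -> nat -> R) k (e : R) :
  block_probabilities a P -> 0 < e ->
  exists I c y phi, convex_weights I c /\
    factors (a 0%N) (a I) k e (fun t => \sum_(i < I) c i * P i t) y phi.
Proof.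
move=> bP e0; pose n := maxn k 2; have n1 : (1 < n)%N by rewrite leq_maxr.
have n0 : (0 < n)%N by lia.
have n0R : 0 < n%:R :> R by rewrite ltr0n.
(* The exceptional mass comes out as at most [12 * d]. *)
pose d := Order.min 1 (e / 16).
have d0 : 0 < d by rewrite lt_min ltr01 divr_gt0.
have d1 : d <= 1 by rewrite ge_min lexx.
have de : d <= e / 16 by rewrite ge_min lexx orbT.
have [I [q [b [c [ndb pq cI hE hmax]]]]] := exists_additive_level bP n1 d0.
set N := a I in pq hmax.
pose h t := n%:R^-1 * \sum_(j < n) q j t.
have hPE t : h t = \sum_(i < I) c i * P i t by exact: hE.
have ph : probability N h by apply: probability_average => // j jn; have [] := pq j jn.
have [h0 sh h1] := ph.
have [x [[x1 xp] xM xd]] := near_maximizer ph d0 d1.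
have [z hz] : exists z : nat -> nat -> R, forall j, (j < n)%N ->
    admissible (q j) (z j) /\ max_entropy N (q j) - d < entropy N (q j) (z j).
  have H j : exists zj, (j < n)%N ->
      admissible (q j) zj /\ max_entropy N (q j) - d < entropy N (q j) zj.
    have [jn|_] := boolP (j < n)%N; last by exists (fun=> 0).
    by have [zj h1' h2] := max_entropy_adherent (pq j jn).1 d0; exists zj.
  by have [f hf] := choice H; exists f.
pose y t := n%:R^-1 * \sum_(j < n) segment (b j) (b j.+1) (z j) t.
have fy : flat n y.
  apply: (@flat_average R n (fun m => segment (b m) (b m.+1) (z m)) b n0 ndb) => j jn; split;
    last exact: segment_supported.
  exact: snorm_le_segment (hz j jn).1.1.
have yE j t : (j < n)%N -> (b j <= t < b j.+1)%N -> y t = n%:R^-1 * z j t.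
  move=> jn ht; congr (_ * _); rewrite (bigD1 (Ordinal jn))//= segmentE ht mul1r big1 ?addr0// =>
    m mj.
  rewrite segmentE (_ : (_ <= t < _)%N = false) ?mul0r//.
  have : (m : nat) <> j by move=> mj'; move/eqP: mj; apply; exact: val_inj.
  by case: (ltngtP m j) => // mj' _; have := ndb _ _ mj'; lia.
have qseg j t : (j < n)%N -> 0 < q j t -> (b j <= t < b j.+1)%N.
  by move=> jn qt; apply/negPn/negP => /(pq j jn).2 e'; rewrite e' ltxx in qt.
have q0 j t : (j < n)%N -> 0 <= q j t by move=> jn; have [] := (pq j jn).1.
have yp t : 0 < h t -> 0 < y t.
  move=> ht; have [j qj] : exists j : 'I_n, 0 < q j t.
    apply/not_existsP => H; move: ht; rewrite /h big1 ?mulr0 ?ltxx// => j _.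
    by apply/eqP; rewrite eq_le q0// andbT leNgt; apply/negP/H.
  rewrite (yE j)//; last exact: qseg.
  by rewrite mulr_gt0 ?invr_gt0//; exact: (hz j _).1.2.
(* On the support of [q j], [y] is [z j / n], which costs [ln n]: exactly the loss at the additive
   level. One [d] comes from that level, the other from the near-maximizers [z j]. *)
have Ey : max_entropy N h - 2 * d <= entropy N h y.
  rewrite /h entropy_average -/h.
  have Hj j : (j < n)%N -> max_entropy N (q j) - d - ln n%:R <= entropy N (q j) y.
    move=> jn; have [az mz] := hz j jn; have pqj := (pq j jn).1.
    have -> : entropy N (q j) y = entropy N (q j) (fun t => n%:R^-1 * z j t).
      apply: eq_bigr => i _; have := q0 j i jn; rewrite le_eqVlt => /predU1P[<-|qi].
        by rewrite !mul0r.
      by rewrite (yE j)//; exact: qseg.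
    by rewrite entropyZ ?invr_gt0 ?lnV ?posrE//; [lra | exact: az.2].
  have : n%:R^-1 * \sum_(j < n) (max_entropy N (q j) - d - ln n%:R) <=
      n%:R^-1 * \sum_(j < n) entropy N (q j) y.
    by apply: ler_wpM2l; [rewrite invr_ge0 ltW | apply: ler_sum => j _; exact: Hj].
  rewrite !sumrB !sum_const_ord !mulrBr !mulKf ?gt_eqF//.
  move: hmax; rewrite -/h; lra.
pose phi j := h j / x j.
have phi0 j : 0 <= phi j by rewrite divr_ge0 ?h0 ?x1.1.
have sphi : supported 0 N phi by move=> j /sh hj; rewrite /phi hj mul0r.
(* Cutting [y] down to the support of [h] puts it in the required interval and changes no product
   with [phi]. *)
pose y' t := if h t == 0 then 0 else y t.
have hs : supported (a 0%N) N h.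
  move=> t ht; rewrite hPE big1// => i _; have [aa _ sP _] := bP.
  have sPi : supported (a 0%N) N (P i).
    by apply: supported_sub (sP i); apply: (homo_ltS aa).
  by rewrite sPi ?mulr0.
have y0 := fy.1.1.
exists I, c, y', phi; split=> //; split.
- apply: (flat_mono (y := y)); last exact: flat_leq (leq_maxl _ _) fy.
  by move=> j; rewrite /y'; case: ifP => _; rewrite ?lexx y0.
- split=> // w w1 M; apply: le_trans (pairing_supported_le M sphi phi0 w1.1) _.
  have := xd w w1; rewrite (eq_bigr (fun i : 'I_N => phi i * w i)).
    by rewrite /pairing; lra.
  by move=> i _; rewrite /phi mulrA mulrAC.
- by move=> j /hs hj; rewrite /y' hj eqxx.
- by move=> j /hs hj; rewrite /phi hj mul0r.
have gap i : h i * (y i / x i - 1 - ln (y i / x i)) >= 0.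
  have := h0 i; rewrite le_eqVlt => /predU1P[<-|hi]; first by rewrite mul0r.
  rewrite mulr_ge0 ?h0//; have := @ln_leB1 R (y i / x i); rewrite divr_gt0 ?yp ?xp// => /(_ isT);
    lra.
(* One [d] is from optimality of [x] tested on [y], the other two from [Ey]. *)
have Hgap : \sum_(i < N) h i * (y i / x i - 1 - ln (y i / x i)) <= 3 * d.
  have -> : \sum_(i < N) h i * (y i / x i - 1 - ln (y i / x i)) =
      \sum_(i < N) h i * (y i / x i) - 1 - (entropy N h y - entropy N h x).
    rewrite -[in RHS]h1 -!sumrB; apply: eq_bigr => i _.
    have := h0 i; rewrite le_eqVlt => /predU1P[<-|hi]; first by rewrite !mul0r !subrr.
    by rewrite ln_div ?posrE ?yp ?xp//; ring.
  have := xd y (fy.1); have := max_entropy_ge ph (conj x1 xp); lra.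
(* A bad coordinate has [y / x < 1/4], so its gap is at least 1/4: Markov's inequality. *)
apply: (@le_trans _ _ (4 * \sum_(i < N) h i * (y i / x i - 1 - ln (y i / x i)))); last by lra.
rewrite mulr_sumr [leRHS](bigID (fun j : 'I_N => 4 * (phi j * y' j) < \sum_(i < I) c i * P i j))/=.
rewrite -[leLHS]addr0; apply: lerD; last first.
  by apply: sumr_ge0 => i _; rewrite mulr_ge0.
apply: ler_sum => i; rewrite -hPE => bad.
have y'0 : 0 <= y' i by rewrite /y'; case: ifP.
have hi : 0 < h i by apply: le_lt_trans bad; rewrite mulr_ge0 ?ler0n// mulr_ge0.
have r4 : y i / x i < 4^-1.
  move: bad; rewrite /y' gt_eqF// /phi.
  rewrite (_ : 4 * (h i / x i * y i) = h i * (4 * (y i / x i))); last by ring.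
  by rewrite gtr_pMr//; lra.
have r0 : 0 < y i / x i by rewrite divr_gt0 ?yp ?xp.
have := ln_ratio_gap r0 r4; move: (y i / x i - 1 - _) => g hg.
by rewrite mulrCA ler_peMr ?(ltW hi)//; lra.
Qed.

(** The previous lemma on the tail from [i0], with coefficients padded by zeros, so that factored
    vectors can be placed arbitrarily far out. *)
Lemma exists_factors a (P : nat -> nat -> R) k (e : R) i0 :
  block_probabilities a P -> 0 < e ->
  exists I c y phi, [/\ (i0 < I)%N, convex_weights I c,
    forall i, (i < i0)%N -> c i = 0 &
    factors (a i0) (a I) k e (fun t => \sum_(i < I) c i * P i t) y phi].
Proof.
move=> [aa P0 sP P1] e0.
have bP' : block_probabilities (fun i => a (i0 + i)%N) (fun i => P (i0 + i)%N).
  by split=> [i|i j|i|i]; rewrite ?addnS.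
have [I [c [y [phi [[c0 c1] F]]]]] := exists_factors0 k bP' e0.
rewrite addn0 in F.
have I0 : (0 < I)%N by case: I c1 {F} => // /eqP; rewrite big_ord0 eq_sym oner_eq0.
pose c' i := if (i < i0)%N then 0 else c (i - i0)%N.
have c'E (G : nat -> R) : \sum_(i < i0 + I) c' i * G i = \sum_(i < I) c i * G (i0 + i)%N.
  rewrite big_split_ord /= [X in X + _]big1; last by move=> i _; rewrite /c' ltn_ord mul0r.
  by rewrite add0r; apply: eq_bigr => i _; rewrite /c' ltnNge leq_addr /= addKn.
exists (i0 + I)%N, c', y, phi; split.
- by rewrite -[X in (X < _)%N]addn0 ltn_add2l.
- split=> [i|]; first by rewrite /c'; case: ifP.
  have /= E := c'E (fun=> 1); rewrite -c1 (eq_bigr (fun i : 'I_(i0 + I) => c' i * 1));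
    last by move=> i _; rewrite mulr1.
  by rewrite E; apply: eq_bigr => i _; rewrite mulr1.
- by move=> i ii; rewrite /c' ii.
- by rewrite (_ : (fun t => _) = (fun t => \sum_(i < I) c i * P (i0 + i)%N t))//; apply/funext =>
  t; exact: (c'E (fun i => P i t)).
Qed.

End Factorization.

(** * The functionals defining the distorting norm *)

Section Witnesses.
Variable R : realType.
Implicit Types (h x y z phi : nat -> R) (a b : nat -> nat).

Implicit Types (u w : nat -> R).

Definition witness n w := (forall j, 0 <= w j) /\
  exists y phi, [/\ flat n y, dual_le2 phi & forall j, w j ^+ 2 <= phi j * y j].

Lemma dual_le2_snorm phi z (t : R) N : dual_le2 phi -> snorm_le z t -> pairing N phi z <= 2 * t.
Proof.
move=> [phi0 hphi] zt; have t0 : 0 <= t by apply: le_trans (zt.1 0%N) (snorm_le_coord 0 zt).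
have [t_gt0|t_le0] := ltP 0 t; last first.
  have te : t = 0 by apply/eqP; rewrite eq_le t_le0.
  rewrite /pairing big1 ?te ?mulr0// => i _; apply/eqP.
  have zi : z i = 0 by apply/eqP; rewrite eq_le zt.1 andbT -te (snorm_le_coord i zt).
  by rewrite zi mulr0.
have ti0 : 0 <= t^-1 by rewrite invr_ge0.
have := snorm_leZ ti0 zt; rewrite mulVf ?gt_eqF// => /hphi /(_ N).
by rewrite pairingZr ler_pdivrMl// mulrC.
Qed.

Lemma witness_sqr_sum n w N : witness n w -> \sum_(i < N) w i ^+ 2 <= 2.
Proof.
move=> [_ [y [phi [fy [_ hphi] wy]]]]; apply: le_trans (hphi y fy.1 N).
by apply: ler_sum => i _; exact: wy.
Qed.

Lemma sum_supported_le M N h : supported 0 N h -> (forall j, 0 <= h j) ->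
  \sum_(j < M) h j <= \sum_(j < N) h j.
Proof.
move=> sh h0; have := @pairing_supported_le R M N h (fun=> 1) sh h0 (fun=> ler01).
by rewrite /pairing; under eq_bigr do rewrite mulr1; under [leRHS]eq_bigr do rewrite mulr1.
Qed.

(** For [w = sqrt (phi y)], [w >= |u| / 2] off the bad set, which carries at most half of the mass
    of [u ^+ 2]. *)
Lemma factors_witness s t k n (e : R) h y phi u :
  factors s t k e h y phi -> (n <= k)%N -> e <= 2^-1 ->
  (forall j, u j ^+ 2 = h j) -> \sum_(j < t) h j = 1 ->
  exists w, witness n w /\ 4^-1 <= \sum_(j < t) w j * `|u j|.
Proof.
move=> [fy dphi _ _ hbad] nk e2 uh h1.
have py j : 0 <= phi j * y j by rewrite mulr_ge0 ?dphi.1 ?fy.1.1.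
exists (fun j => Num.sqrt (phi j * y j)); split.
  split=> [j|]; first exact: sqrtr_ge0.
  exists y, phi; split=> //; first exact: flat_leq fy.
  by move=> j; rewrite sqr_sqrtr.
apply: (@le_trans _ _ (2^-1 * \sum_(j < t | ~~ (4 * (phi j * y j) < h j)) h j)).
  move: h1; rewrite (bigID (fun j : 'I_t => 4 * (phi j * y j) < h j))/=.
  move: hbad; move: (bigop.body _ _ _) (bigop.body _ _ _) => A B; lra.
rewrite mulr_sumr [leRHS](bigID (fun j : 'I_t => 4 * (phi j * y j) < h j))/=.
rewrite -[leLHS]add0r; apply: lerD; first by apply: sumr_ge0 => j _; rewrite mulr_ge0 ?sqrtr_ge0.
apply: ler_sum => j; rewrite -leNgt => hj.
rewrite -uh -real_normK ?num_real// expr2 mulrA ler_wpM2r//.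
rewrite -sqrtr_sqr uh ler_pdivrMl//.
have -> : 2 = Num.sqrt 4 :> R.
  have -> : 4 = 2 ^+ 2 :> R by ring.
  by rewrite sqrtr_sqr ger0_norm ?ler0n.
by rewrite -sqrtrM ?ler0n// ler_wsqrtr.
Qed.

(** AM-GM with a free parameter on each of the two products. Being linear in [A], [B], [C], [D], the
    bound can be summed over coordinates, in place of Cauchy-Schwarz. *)
Lemma ler_sqr_sum_amgm (s A B C D p : R) : 0 < s -> 0 <= A -> 0 <= B -> 0 <= C -> 0 <= D ->
  p ^+ 2 <= 4 * A * B + C * D -> p <= s * A + s^-1 * B + 2^-1 * (s * C + s^-1 * D).
Proof.
move=> s0 A0 B0 C0 D0 hp.
have s'0 : 0 < s^-1 by rewrite invr_gt0.
have ss : s * s^-1 = 1 by rewrite divff// gt_eqF.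
move: (s^-1) s'0 ss => r r0 sr.
set a := s * A + r * B; set b := 2^-1 * (s * C + r * D).
have a0 : 0 <= a by rewrite addr_ge0// mulr_ge0// ltW.
have b0 : 0 <= b by rewrite mulr_ge0 ?invr_ge0// addr_ge0// mulr_ge0// ltW.
have ha : 4 * A * B <= a ^+ 2.
  rewrite -subr_ge0 (_ : _ - _ = (s * A - r * B) ^+ 2) ?sqr_ge0//.
  have -> : 4 * A * B = 4 * (s * r) * A * B by rewrite sr; ring.
  by rewrite /a; ring.
have hb : C * D <= b ^+ 2.
  rewrite -subr_ge0 (_ : _ - _ = (2^-1 * (s * C - r * D)) ^+ 2) ?sqr_ge0//.
  have -> : C * D = (s * r) * C * D by rewrite sr; ring.
  by rewrite /b; field.
have : p ^+ 2 <= (a + b) ^+ 2.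
  apply: (le_trans hp); rewrite sqrrD; have := mulr_ge0 a0 b0; lra.
have ab : 0 <= a + b by rewrite addr_ge0.
by move=> h; rewrite leNgt; apply/negP => pab; nra.
Qed.

(** With [X] the sum of the [phi j] and [Y] the average of the [y j], [u ^+ 2 <= 4 X Y] up to a bad
    part of mass [s ^+ 2]. Pairing crosswise, [X] with [eta] is bounded by flatness and [psi] with
    [Y] is small. *)
Lemma witness_average_le n (s : R) w N b (h y phi : nat -> nat -> R) (k : nat -> nat) u :
  (0 < n)%N -> 0 < s -> (forall j, (b j < b j.+1)%N) ->
  (forall j, factors (b j) (b j.+1) (k j) (s ^+ 2) (h j) (y j) (phi j)) ->
  (forall j i, 0 <= h j i) -> (forall j, supported 0 (b j.+1) (h j)) ->
  snorm_le (fun i => n%:R^-1 * \sum_(j < n) y j i) (s ^+ 2) ->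
  (forall i, u i ^+ 2 = n%:R^-1 * \sum_(j < n) h j i) ->
  witness n w -> \sum_(i < N) w i * `|u i| <= 8 * s.
Proof.
move=> n0 s0 bb F h0 sh Yt uE ww; have ndb := homo_ltS bb.
have [w0 [eta [psi [feta dpsi wE]]]] := ww.
have n0R : 0 < n%:R :> R by rewrite ltr0n.
have ni0 : 0 <= n%:R^-1 :> R by rewrite invr_ge0 ltW.
pose X i := \sum_(j < n) phi j i.
pose Y i := n%:R^-1 * \sum_(j < n) y j i.
pose bad j i : bool := 4 * (phi j i * y j i) < h j i.
pose B i := n%:R^-1 * \sum_(j < n) (bad j i)%:R * h j i.
have phi0 j i : 0 <= phi j i by have [_ [p _] _ _ _] := F j; exact: p.
have y0 j i : 0 <= y j i by have [[[p _] _] _ _ _ _] := F j; exact: p.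
have X0 i : 0 <= X i by apply: sumr_ge0.
have Y0 i : 0 <= Y i by rewrite mulr_ge0// sumr_ge0.
have B0 i : 0 <= B i by rewrite mulr_ge0// sumr_ge0// => j _; rewrite mulr_ge0.
have H i : u i ^+ 2 <= 4 * (X i * Y i) + B i.
  rewrite uE /Y /B (_ : 4 * _ + _ = n%:R^-1 * (4 * (X i * \sum_(j < n) y j i) + \sum_(j < n) (bad
    j i)%:R * h j i)); last by ring.
  apply: ler_wpM2l => //.
  apply: (@le_trans _ _ (\sum_(j < n) (4 * (phi j i * y j i) + (bad j i)%:R * h j i))).
    apply: ler_sum => j _; have [_|] := boolP (bad j i).
      by rewrite mul1r lerDr mulr_ge0 ?ler0n// mulr_ge0.
    by rewrite mul0r addr0 /bad -leNgt.
  rewrite big_split /= lerD2r -mulr_sumr ler_wpM2l ?ler0n// mulr_sumr.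
  apply: ler_sum => j _; apply: ler_wpM2r => //.
  by rewrite /X (bigD1 j)//= lerDl sumr_ge0.
have pt i : w i * `|u i| <= s * (X i * eta i) + s^-1 * (psi i * Y i) +
    2^-1 * (s * w i ^+ 2 + s^-1 * B i).
  have e0 : 0 <= eta i := feta.1.1 i.
  have p0 : 0 <= psi i := dpsi.1 i.
  apply: ler_sqr_sum_amgm => //; [exact: mulr_ge0 | exact: mulr_ge0 | exact: sqr_ge0 |].
  rewrite exprMn real_normK ?num_real//.
  apply: (@le_trans _ _ (w i ^+ 2 * (4 * (X i * Y i) + B i))); first by rewrite ler_wpM2l ?sqr_ge0.
  rewrite mulrDr lerD2r.
  apply: (@le_trans _ _ ((psi i * eta i) * (4 * (X i * Y i)))).
    by rewrite ler_wpM2r ?wE// mulr_ge0 ?ler0n// mulr_ge0.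
  by rewrite (_ : psi i * eta i * _ = 4 * (X i * eta i) * (psi i * Y i))//; ring.
(* The supports of the [phi j] cut [eta] into [n] pieces, whose norms sum to at most 2. *)
have S1 : \sum_(i < N) X i * eta i <= 4.
  have [t [ht st]] := feta.2 n (leqnn n) b ndb.
  rewrite -/(pairing N X eta) (@pairing_suml R N n phi eta).
  apply: (@le_trans _ _ (\sum_(j < n) 2 * t j)); last by rewrite -mulr_sumr; lra.
  apply: ler_sum => j _; have [_ dphi _ sphi _] := F j.
  by rewrite -{1}(segment_id sphi) pairing_segmentC; exact: dual_le2_snorm.
have S2 : \sum_(i < N) psi i * Y i <= 2 * s ^+ 2 by exact: dual_le2_snorm.
have S3 := witness_sqr_sum N ww.
have S4 : \sum_(i < N) B i <= s ^+ 2.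
  rewrite -mulr_sumr exchange_big /= ler_pdivrMl//.
  rewrite -(sum_const_ord n (s ^+ 2)); apply: ler_sum => j _.
  have [_ _ _ _ hb] := F j; apply: le_trans hb.
  apply: le_trans (_ : _ <= \sum_(i < b j.+1) (bad j i)%:R * h j i) _.
    by apply: (@sum_supported_le N (b j.+1) (fun i => (bad j i)%:R * h j i)) => i;
      [move/(sh j) ->; rewrite mulr0 | rewrite mulr_ge0].
  rewrite [leRHS]big_mkcond; apply: ler_sum => i _.
  by rewrite /bad; case: ifP; rewrite ?mul1r ?mul0r.
apply: le_trans; first by apply: ler_sum => i _; exact: pt.
rewrite !big_split /= -[X in X + _ + _]mulr_sumr -[X in _ + X + _]mulr_sumr -[X in _ + _ +
  X]mulr_sumr.
rewrite big_split /= -[X in _ * (X + _)]mulr_sumr -[X in _ * (_ + X)]mulr_sumr.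
have s'0 : 0 < s^-1 by rewrite invr_gt0.
have e1 : s * \sum_(i < N) X i * eta i <= s * 4 by rewrite ler_pM2l.
have e2 : s^-1 * \sum_(i < N) psi i * Y i <= 2 * s.
  by apply: le_trans (ler_wpM2l (ltW s'0) S2) _; rewrite mulrCA expr2 mulKf// gt_eqF.
have e3 : s * \sum_(i < N) w i ^+ 2 <= s * 2 by rewrite ler_pM2l.
have e4 : s^-1 * \sum_(i < N) B i <= s.
  by apply: le_trans (ler_wpM2l (ltW s'0) S4) _; rewrite expr2 mulKf// gt_eqF.
(* The total is [4 s + 2 s + (2 s + s) / 2], below [8 s]. *)
move: e1 e2 e3 e4.
move: (s * \sum_(i < N) _) (s^-1 * \sum_(i < N) _) (s * \sum_(i < N) _) (s^-1 * \sum_(i < N) _).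
move=> A C D G; lra.
Qed.

End Witnesses.

(** * Large and small vectors for any block probabilities *)

Section Separation.
Variable R : realType.
Implicit Types (h x y z phi : nat -> R) (a b : nat -> nat).

Implicit Types (u w : nat -> R).

(** With [eps = t / 4] and [2^-1 ^+ d <= eps], the error coefficient is at most [t / 2]; [n] is then
    so large that [C / n <= t / 2]. *)
Lemma exists_flat_average_le (t : R) : 0 < t -> exists eps : R, exists n, [/\ 0 < eps, (0 < n)%N &
  forall (y : nat -> nat -> R) b k, rapidly_increasing eps y b k ->
    snorm_le (fun i => n%:R^-1 * \sum_(j < n) y j i) t].
Proof.
move=> t0; pose eps := t / 4; have eps0 : 0 < eps by rewrite divr_gt0.
have [L [L1 hL]] := weight_unbounded (2 / eps).
have hL' : 2 <= eps * weight L by rewrite mulrC -ler_pdivrMr.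
have [d [_ hd]] := weight_unbounded eps^-1.
have hd' : 2^-1 ^+ d <= eps.
  rewrite exprVn -[leRHS]invrK lef_pV2 ?posrE ?invr_gt0 ?exprn_gt0//.
  apply: (le_trans hd); rewrite /weight -natrX ler_nat.
  apply: leq_ltn_trans (leq_trunc_log 2 (_ : d <= 2 ^ d)%N) _; first exact/ltnW/ltn_expl.
  by rewrite trunc_expnK// ltn_expl.
have [C [C0 hC]] := rapidly_increasing_average eps0 L1 hL' d.
pose n := (Num.truncn (2 * C / t)).+1.
have hn : C <= n%:R * (t / 2).
  have : 2 * C / t < n%:R by rewrite /n truncnS_gt.
  by rewrite ltr_pdivrMr//; lra.
exists eps, n; split=> // y b k ris; have [bb sy fy kb] := ris.
have n0R : 0 < n%:R :> R by rewrite ltr0n.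
split=> [j|phi N nphi].
  by rewrite mulr_ge0 ?invr_ge0// sumr_ge0// => i _; exact: (fy i).1.1.
rewrite pairingZr ler_pdivrMl// (@pairing_sumr R N phi n y predT).
have := hC y b k ris n predT phi N nphi; rewrite sum_const_ord mulr1 => h.
apply: (le_trans h); apply: (@le_trans _ _ (n%:R * (t / 2) + (t / 2) * n%:R)); last by lra.
apply: lerD => //; rewrite ler_wpM2r//; move: hd'; rewrite /eps; lra.
Qed.

(** It matters that [n] depends on [s] alone: one norm must serve for all subspaces. *)
Lemma separating_witnesses (s : R) : 0 < s -> s <= 2^-1 -> exists n, forall a (P : nat -> nat -> R),
  block_probabilities a P ->
  (exists I c, convex_weights I c /\
     forall u, (forall t, u t ^+ 2 = \sum_(i < I) c i * P i t) ->
       exists w N, witness n w /\ 4^-1 <= \sum_(j < N) w j * `|u j|) /\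
  (exists I c, convex_weights I c /\
     forall u, (forall t, u t ^+ 2 = \sum_(i < I) c i * P i t) ->
       forall w N, witness n w -> \sum_(j < N) w j * `|u j| <= 8 * s).
Proof.
move=> s0 s2; have ss0 : 0 < s ^+ 2 by rewrite exprn_gt0.
have ss2 : s ^+ 2 <= 2^-1 by rewrite expr2; nra.
have [eps [n [eps0 n0 hn]]] := exists_flat_average_le ss0.
have n0R : 0 < n%:R :> R by rewrite ltr0n.
exists n => a P bP; have [aa P0 sP P1] := bP; have nda := homo_ltS aa.
have sumP I c : convex_weights I c -> \sum_(t < a I) \sum_(i < I) c i * P i t = 1.
  move=> [_ c1]; rewrite exchange_big /= -[RHS]c1; apply: eq_bigr => i _.
  by rewrite -mulr_sumr; have [_ _ ->] := block_probability bP (ltn_ord i); rewrite mulr1.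
split.
  have [I [c [y [phi [_ cI _ F]]]]] := exists_factors n 0 bP ss0.
  exists I, c; split=> // u hu.
  have [w [ww hw]] := factors_witness F (leqnn n) ss2 hu (sumP _ _ cI).
  by exists w, (a I).
(* The flatness is chosen after the starting point [a i0]; iterating from each endpoint [idx j]
   yields a rapidly increasing sequence. *)
have H i0 : exists r : nat * (nat * (nat -> R)) * ((nat -> R) * (nat -> R)),
    [/\ (a i0)%:R <= eps * weight r.1.1 & [/\ (i0 < r.1.2.1)%N, convex_weights r.1.2.1 r.1.2.2 &
    factors (a i0) (a r.1.2.1) r.1.1 (s ^+ 2)
      (fun t => \sum_(i < r.1.2.1) r.1.2.2 i * P i t) r.2.1 r.2.2]].
  have [k [_ hk]] := weight_unbounded ((a i0)%:R / eps).
  have [I [c [y [phi [iI cI _ F]]]]] := exists_factors k i0 bP ss0.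
  exists (k, (I, c), (y, phi)); split=> //=.
  by rewrite mulrC -ler_pdivrMr.
have [g hg] := choice H.
pose idx := fix idx j := if j is j'.+1 then (g (idx j')).1.2.1 else 0%N.
have idxS j : idx j.+1 = (g (idx j)).1.2.1 by [].
pose h j t := \sum_(i < idx j.+1) (g (idx j)).1.2.2 i * P i t.
have idx_lt j : (idx j < idx j.+1)%N by have [_ []] := hg (idx j).
pose b j := a (idx j).
have bb j : (b j < b j.+1)%N.
  by apply: leq_trans (nda _ _ (idx_lt j)); exact: aa.
have F j : factors (b j) (b j.+1) (g (idx j)).1.1 (s ^+ 2) (h j) (g (idx j)).2.1 (g (idx j)).2.2.
  by have [_ []] := hg (idx j).
have cw j : convex_weights (idx j.+1) (g (idx j)).1.2.2 by have [_ []] := hg (idx j).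
have ris : rapidly_increasing eps (fun j => (g (idx j)).2.1) b (fun j => (g (idx j)).1.1).
  split=> // j; first by have [] := F j.
    by have [] := F j.
  by have [] := hg (idx j).
have idx_le j m : (j <= m)%N -> (idx j <= idx m)%N by apply: homo_ltS.
(* The average of the first [n] coefficient vectors, each extended by zero. *)
pose c i := n%:R^-1 * \sum_(j < n) if (i < idx j.+1)%N then (g (idx j)).1.2.2 i else 0.
have cE (G : nat -> R) : \sum_(i < idx n) c i * G i =
    n%:R^-1 * \sum_(j < n) \sum_(i < idx j.+1) (g (idx j)).1.2.2 i * G i.
  under eq_bigr do rewrite /c -mulrA mulr_suml.
  rewrite -mulr_sumr exchange_big /=; congr (_ * _); apply: eq_bigr => j _.
  rewrite (big_ord_widen (idx n) (fun i => (g (idx j)).1.2.2 i * G i)) ?(idx_le j.+1)//.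
  rewrite [RHS]big_mkcond; apply: eq_bigr => i _ /=.
  by case: ifP; rewrite ?mul0r.
exists (idx n), c; split.
  split=> [i|].
    rewrite mulr_ge0 ?invr_ge0 ?ler0n// sumr_ge0// => j _.
    by case: ifP => // _; have [] := cw j.
  have /= E := cE (fun=> 1).
  rewrite (eq_bigr (fun i : 'I_(idx n) => c i * 1)); last by move=> i _; rewrite mulr1.
  rewrite E (eq_bigr (fun=> 1)) ?sum_const_ord ?mulr1 ?mulVf ?gt_eqF// => j _.
  by under eq_bigr do rewrite mulr1; have [] := cw j.
move=> u hu w N ww; apply: (@witness_average_le _ n s w N b h _ _ _ u n0 s0 bb F).
- by move=> j i; apply: sumr_ge0 => m _; rewrite mulr_ge0//; have [] := cw j.
- move=> j t ht; apply: big1 => i _.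
  have sPi : supported 0 (b j.+1) (P i).
    by apply: supported_sub (sP i) => //; apply: nda; exact: ltn_ord.
  by rewrite sPi ?mulr0.
- exact: hn ris.
- by move=> t; rewrite hu; exact: (cE (fun i => P i t)).
- by [].
Qed.

End Separation.

(** * Block vectors in subspaces of l_2 *)

Section Ell2.
Variable R : realType.
Implicit Types (x y z u v : ell2 R) (w f : nat -> R) (Y : set (ell2 R)).

Lemma ell2D x y i : (x + y : ell2 R) i = x i + y i. Proof. by []. Qed.
Lemma ell2N x i : (- x : ell2 R) i = - x i. Proof. by []. Qed.
Lemma ell2Z (c : R) x i : (c *: x : ell2 R) i = c * x i. Proof. by []. Qed.
Lemma ell20 i : (0 : ell2 R) i = 0. Proof. by []. Qed.

Lemma ell2_sum n (F : 'I_n -> ell2 R) i : (\sum_(j < n) F j : ell2 R) i = \sum_(j < n) F j i.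
Proof.
elim: n F => [|n IH] F; first by rewrite !big_ord0.
by rewrite !big_ord_recl ell2D IH.
Qed.

Lemma ell2_partial_sum x N : \sum_(i < N) x i ^+ 2 <= `|x| ^+ 2.
Proof.
rewrite -[`|x|]/(l2norm x) (l2norm_sqr (valP x)).
by have := sqseries_le_lim N (valP x); rewrite /series /= big_mkord.
Qed.

Lemma ell2_norm_le x (M : R) : 0 <= M -> (forall N, \sum_(i < N) x i ^+ 2 <= M ^+ 2) -> `|x| <= M.
Proof.
move=> M0 h; have [|_ //] := @l2normP R x M M0.
by move=> n; rewrite /series /= big_mkord.
Qed.

Lemma finite_support_ell2 f N : supported 0 N f -> exists x : ell2 R, forall i, x i = f i.
Proof.
move=> sf; have [h _] : f \in @square_summable R /\ limn (series (fun n =>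
  f n ^+ 2)) <= \sum_(i < N) f i ^+ 2.
  apply: square_summable_bound => n; rewrite /series /= big_mkord.
  by apply: (@sum_supported_le R n N (fun i => f i ^+ 2)) => i; rewrite ?sqr_ge0// => /sf ->;
    rewrite expr0n.
by exists (Ell2 h).
Qed.

Lemma finite_support_norm x N : supported 0 N x -> `|x| ^+ 2 = \sum_(i < N) x i ^+ 2.
Proof.
move=> sx; apply/eqP; rewrite eq_le ell2_partial_sum andbT.
have S0 : 0 <= \sum_(i < N) x i ^+ 2 by apply: sumr_ge0 => i _; exact: sqr_ge0.
rewrite -[leRHS]sqr_sqrtr// lerXn2r ?nnegrE ?sqrtr_ge0//.
apply: ell2_norm_le => [|M]; rewrite ?sqrtr_ge0// sqr_sqrtr//.
by apply: (@sum_supported_le R M N (fun i => x i ^+ 2)) => i; rewrite ?sqr_ge0// => /sx ->;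
  rewrite expr0n.
Qed.

Lemma exists_truncation x (e : R) : 0 < e -> exists N0, forall N, (N0 <= N)%N ->
  exists y, (forall i, y i = if (i < N)%N then x i else 0) /\ `|x - y| <= e.
Proof.
move=> e0; have cx := square_summableP _ (valP x).
have : \forall n \near \oo, `|limn (series (fun n => x n ^+ 2)) - series (fun n =>
  x n ^+ 2) n| < e ^+ 2.
  by have /cvgrPdist_lt := cx; apply; rewrite exprn_gt0.
move=> [N0 _ hN0]; exists N0 => N NN.
have sf : supported 0 N (fun i => if (i < N)%N then x i else 0).
  by move=> j; rewrite leq0n /= => /negPf ->.
have [y hy] := finite_support_ell2 sf.
exists y; split=> //; apply: ell2_norm_le => [|M]; first exact: ltW.
have := hN0 N NN; rewrite ger0_norm ?subr_ge0 ?sqseries_le_lim ?(valP x)// => h.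
apply: le_trans (ltW h); rewrite lerBrDr.
apply: le_trans (sqseries_le_lim (maxn M N) (valP x)).
rewrite /series /= !big_mkord.
have E : \sum_(i < N) x i ^+ 2 = \sum_(i < maxn M N) (i < N)%N%:R * x i ^+ 2.
  rewrite (big_ord_widen (maxn M N) (fun i => x i ^+ 2)) ?leq_maxr// big_mkcond.
  by apply: eq_bigr => i _; case: ifP; rewrite ?mul1r ?mul0r.
have E' : \sum_(i < M) (x - y : ell2 R) i ^+ 2 <= \sum_(i < maxn M N) (N <= i)%N%:R * x i ^+ 2.
  have -> : \sum_(i < M) (x - y : ell2 R) i ^+ 2 = \sum_(i < M) (N <= i)%N%:R * x i ^+ 2.
    apply: eq_bigr => i _; rewrite ell2D ell2N hy ltnNge.
    by case: leqP => _ /=; rewrite ?subr0 ?subrr ?expr0n ?mul1r ?mul0r.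
  rewrite (big_ord_widen (maxn M N) (fun i => (N <= i)%N%:R * x i ^+ 2)) ?leq_maxl// big_mkcond /=.
  by apply: ler_sum => i _; case: ifP => _; [exact: lexx | rewrite mulr_ge0 ?ler0n// sqr_ge0].
rewrite E; apply: (le_trans (lerD E' (lexx _))); rewrite -big_split /=.
by apply: ler_sum => i _; case: leqP => _ /=; rewrite ?mul1r ?mul0r ?addr0 ?add0r.
Qed.

Definition subspace Y := Y 0 /\ forall (c : R) x y, Y x -> Y y -> Y (c *: x + y).

Lemma submod_closed_subspace Y : submod_closed (mem Y) -> subspace Y.
Proof.
move=> [Y0 YD]; split=> [|c x y Yx Yy].
  by have := Y0; rewrite !inE.
have := YD c x y; rewrite !inE; exact.
Qed.

(** The kernel of a coordinate has codimension at most 1: one vector [y0] outside it completes a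
    finite spanning family. *)
Lemma infinite_dimensional_coord_kernel Y i : subspace Y -> infinite_dimensional Y ->
  infinite_dimensional (Y `&` [set x | x i = 0]).
Proof.
move=> [Y0 YD] iY [n [b [Yb bY]]]; apply: iY.
have [H|/existsNP[y0 /not_implyP[Yy0 y0i]]] := pselect (forall y, Y y -> y i = 0).
  by exists n, b; split=> [j|y Yy]; [have [] := Yb j | apply: bY; split=> //; exact: H].
have {}y0i : y0 i != 0 by apply/eqP.
exists n.+1, (fun j => if unlift ord0 j is Some k then b k else y0); split.
  by move=> j; case: unliftP => [k _|_] //; have [] := Yb k.
move=> y Yy; have [a ha] : exists a : 'I_n -> R, - (y i / y0 i) *: y0 + y = \sum_(k < n) a k *: b k.
  apply: bY; split; first exact: YD.
  change ((- (y i / y0 i) *: y0 + y : ell2 R) i = 0).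
  by rewrite ell2D ell2Z mulNr divfK// addNr.
exists (fun j => if unlift ord0 j is Some k then a k else y i / y0 i).
rewrite big_ord_recl unlift_none; under eq_bigr do rewrite liftK.
by rewrite -ha scaleNr addNKr.
Qed.

Lemma exists_nonzero_vanishing Y N : subspace Y -> infinite_dimensional Y ->
  exists x, [/\ Y x, x != 0 & forall i, (i < N)%N -> x i = 0].
Proof.
move=> sY iY.
have [sZ iZ] : subspace (Y `&` [set x | forall i, (i < N)%N -> x i = 0]) /\
    infinite_dimensional (Y `&` [set x | forall i, (i < N)%N -> x i = 0]).
  elim: N => [|N [sZ iZ]].
    by rewrite (_ : _ `&` _ = Y)//; apply/seteqP; split=> [x []|x Yx].
  have -> : Y `&` [set x | forall i, (i < N.+1)%N -> x i = 0] =
      (Y `&` [set x | forall i, (i < N)%N -> x i = 0]) `&` [set x | x N = 0].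
    apply/seteqP; split=> [x [Yx xi]|x [[Yx xi] xN]].
      by split; [split=> // i iN; apply: xi; exact: ltnW | exact: xi].
    by split=> // i; rewrite ltnS leq_eqVlt => /predU1P[->|/xi].
  split; last exact: infinite_dimensional_coord_kernel.
  have [Z0 ZD] := sZ; split=> [|c x y [Zx xN] [Zy yN]]; first by split.
  split; first exact: ZD.
  change ((c *: x + y : ell2 R) N = 0); by rewrite ell2D ell2Z xN yN mulr0 addr0.
apply/not_existsP => H; apply: iZ; exists 0%N, (fun=> 0); split=> [[]//|x [Yx xi]].
exists (fun=> 0); rewrite big_ord0; apply/eqP/negPn/negP => x0.
by apply: (H x); split.
Qed.

(** Gliding hump: truncate a vector of [Y] that vanishes below [N]. *)
Lemma exists_block Y N (e : R) : subspace Y -> infinite_dimensional Y -> 0 < e ->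
  exists v u M, [/\ Y v, (N < M)%N, supported N M u, \sum_(j < M) u j ^+ 2 = 1 & `|v - u| <= e].
Proof.
move=> sY iY e0; have [x [Yx xn0 xi]] := exists_nonzero_vanishing N sY iY.
have nx : 0 < `|x| by rewrite normr_gt0.
(* The first bound keeps the truncation at least half as long as [x]; the second leaves an error [e]
   after normalizing. *)
pose d := Order.min (`|x| / 2) (e * (`|x| / 2)).
have nx2 : 0 < `|x| / 2 by rewrite divr_gt0.
have d0 : 0 < d by rewrite lt_min nx2 mulr_gt0.
have d1 : d <= `|x| / 2 by rewrite ge_min lexx.
have d2 : d <= e * (`|x| / 2) by rewrite ge_min lexx orbT.
have [M0 hM] := exists_truncation x d0.
pose M := maxn M0 N.+1.
have [y [yE xy]] := hM M (leq_maxl _ _).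
have sy : supported N M y.
  move=> j hj; rewrite yE; case: ifP => // jM; apply: xi; lia.
have ny : `|x| / 2 <= `|y|.
  have := ler_normD (x - y) y; rewrite subrK; lra.
have ny0 : 0 < `|y| by lra.
exists (`|y|^-1 *: x), (`|y|^-1 *: y), M; split.
- by rewrite -[_ *: x]addr0; apply: sY.2 => //; exact: sY.1.
- by rewrite leq_maxr.
- by move=> j /sy hj; rewrite ell2Z hj mulr0.
- under eq_bigr do rewrite ell2Z exprMn.
  rewrite -mulr_sumr -finite_support_norm; first by rewrite exprVn mulVf// expf_neq0// gt_eqF.
  by apply: supported_sub sy.
- rewrite -scalerBr normrZ normfV normr_id ler_pdivrMl//.
  by apply: (le_trans xy); apply: (le_trans d2); rewrite mulrC ler_wpM2r// ltW.
Qed.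

Lemma exists_block_sequence Y (d : R) : subspace Y -> infinite_dimensional Y -> 0 < d ->
  exists a (v u : nat -> ell2 R), [/\ forall i, Y (v i), forall i, (a i < a i.+1)%N,
    forall i, supported (a i) (a i.+1) (u i), forall i, \sum_(j < a i.+1) u i j ^+ 2 = 1 &
    forall i, `|v i - u i| <= d * 2^-1 ^+ i.+1].
Proof.
move=> sY iY d0.
(* [p] holds the left endpoint and the step number, on which the tolerance depends. *)
have H (p : nat * nat) : exists r : ell2 R * ell2 R * nat,
    [/\ Y r.1.1, (p.1 < r.2)%N, supported p.1 r.2 r.1.2, \sum_(j < r.2) r.1.2 j ^+ 2 = 1 &
        `|r.1.1 - r.1.2| <= d * 2^-1 ^+ p.2.+1].
  have e0 : 0 < d * 2^-1 ^+ p.2.+1 by rewrite mulr_gt0// exprn_gt0// invr_gt0 ltr0n.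
  have [v [u [M h]]] := exists_block p.1 sY iY e0.
  by exists (v, u, M).
have [g hg] := choice H.
pose a := fix a i := if i is i'.+1 then (g (a i', i')).2 else 0%N.
exists a, (fun i => (g (a i, i)).1.1), (fun i => (g (a i, i)).1.2).
by split=> i; have [] := hg (a i, i).
Qed.

Lemma sum_geometric_half n : \sum_(i < n) 2^-1 ^+ i.+1 <= 1 :> R.
Proof.
have -> : \sum_(i < n) 2^-1 ^+ i.+1 = 1 - 2^-1 ^+ n :> R.
  elim: n => [|n IH]; first by rewrite big_ord0 expr0 subrr.
  by rewrite big_ord_recr /= IH exprS; field.
by rewrite gerBl exprn_ge0// invr_ge0 ler0n.
Qed.

(** Squares of disjoint unit blocks are probabilities. The combination with coefficients
    [sqrt (c i)] squares to the convex combination, and the same combination of the [v i] stays in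
    [Y]. *)
Lemma exists_block_probabilities Y (d : R) : subspace Y -> infinite_dimensional Y ->
  0 < d -> d < 1 ->
  exists a P, block_probabilities a P /\ forall I c, convex_weights I c ->
    exists v u, [/\ Y v, `|v| = 1, `|v - u| <= 2 * d &
      forall t, u t ^+ 2 = \sum_(i < I) c i * P i t].
Proof.
move=> sY iY d0 d1; have [a [v [u [Yv aa su u1 vu]]]] := exists_block_sequence sY iY d0.
exists a, (fun i t => u i t ^+ 2); split.
  by split=> // i j; [exact: sqr_ge0 | move=> /su ->; rewrite expr0n].
move=> I c [c0 c1].
pose V : ell2 R := \sum_(i < I) Num.sqrt (c i) *: v i.
pose U : ell2 R := \sum_(i < I) Num.sqrt (c i) *: u i.
have c_le1 (i : 'I_I) : Num.sqrt (c i) <= 1.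
  by rewrite -[leRHS]sqrtr1 ler_wsqrtr// -c1 (bigD1 i)//= lerDl sumr_ge0.
have VU : `|V - U| <= d.
  rewrite /V /U -sumrB; apply: le_trans (ler_norm_sum _ _ _) _.
  apply: (@le_trans _ _ (\sum_(i < I) d * 2^-1 ^+ i.+1)).
    apply: ler_sum => i _; rewrite -scalerBr normrZ ger0_norm ?sqrtr_ge0//.
    apply: le_trans (vu i); by rewrite ler_piMl.
  by rewrite -mulr_sumr ler_piMr ?sum_geometric_half// ltW.
have Ut t : U t = \sum_(i < I) Num.sqrt (c i) * u i t.
  by rewrite ell2_sum; apply: eq_bigr => i _.
have UE t : U t ^+ 2 = \sum_(i < I) c i * u i t ^+ 2.
  have ut i j : (i < j)%N -> u i t != 0 -> u j t = 0.
    move=> ij ui; apply: (su j); apply: contra_neqN ui => /andP[h1 _]; apply: (su i).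
    by have := homo_ltS aa ij; lia.
  have [/existsP[i0 hi0]|/existsPn H] := boolP [exists i : 'I_I, u i t != 0].
    have oth (i : 'I_I) : i != i0 -> u i t = 0.
      move=> ii; have : (i : nat) <> i0 by move=> e; move/eqP: ii; apply; exact: val_inj.
      case: (ltngtP i i0) => // h _; last exact: ut hi0.
      by apply/eqP; apply: contraTT hi0 => /(ut _ _ h) ->; rewrite eqxx.
    rewrite Ut (bigD1 i0)//= [in RHS](bigD1 i0)//= !big1 ?addr0.
    - by rewrite exprMn sqr_sqrtr.
    - by move=> i /oth ->; rewrite expr0n mulr0.
    - by move=> i /oth ->; rewrite mulr0.
  have z i : (i < I)%N -> u i t = 0.
    by move=> iI; have := H (Ordinal iI); rewrite negbK => /eqP.
  rewrite Ut !big1 ?expr0n// => i _; first by rewrite z// expr0n mulr0.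
  by rewrite z// mulr0.
have U1 : `|U| = 1.
  have sU : supported 0 (a I) U.
    move=> t ht; rewrite Ut big1// => i _; rewrite su ?mulr0//.
    by have := homo_ltS aa (ltn_ord i); lia.
  apply/eqP; rewrite -(@eqrXn2 _ 2)// expr1n (finite_support_norm sU).
  under eq_bigr do rewrite UE.
  rewrite exchange_big /= -c1; apply/eqP; apply: eq_bigr => i _.
  rewrite -mulr_sumr -[RHS]mulr1 -(u1 i); congr (_ * _).
  apply: (@sum_supported R (a i) (a i.+1) (a I) (fun t => u i t ^+ 2)).
    exact: (homo_ltS aa (ltn_ord i)).
  by move=> t /su ->; rewrite expr0n.
have V1 : `| `|V| - 1 | <= d by rewrite -U1; apply: le_trans (ler_dist_dist _ _) VU.
have Vp : 0 < `|V| by move: V1; rewrite ler_norml; lra.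
have YV : Y V.
  rewrite /V; elim: I {c1 U c_le1 VU Ut UE U1 V1 Vp} @V => [|I IH] /=; first by rewrite big_ord0;
    exact: sY.1.
  by rewrite big_ord_recr /= addrC; apply: sY.2.
exists (`|V|^-1 *: V), U; split=> //.
- by rewrite -[_ *: V]addr0; apply: sY.2 => //; exact: sY.1.
- by rewrite normrZ normfV normr_id mulVf// gt_eqF.
(* One [d] is the distance from [V] to [U], the other the cost of normalizing [V]. *)
- have -> : `|V|^-1 *: V - U = (`|V|^-1 - 1) *: V + (V - U) by rewrite scalerBl scale1r addrA subrK.
  apply: le_trans (ler_normD _ _) _; rewrite (_ : 2 * d = d + d); last by ring.
  apply: lerD => //; rewrite normrZ -[X in _ * X]normr_id -normrM mulrBl mulVf ?gt_eqF//.
  by rewrite mul1r distrC.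
Qed.

End Ell2.

(** * The distorting norm and the conclusion *)

Section Distortion.
Variable R : realType.
Implicit Types (x y u v : ell2 R) (w : nat -> R).

Definition witness_norm n x : R := sup [set r : R | exists w N, witness n w /\
  r = \sum_(i < N) w i * `|x i|].

Lemma witness0 n : witness n (fun=> 0 : R).
Proof.
split=> //; exists (fun=> 0), (fun=> 0); split.
- split; first exact: snorm_le0.
  move=> l _ a _; exists (fun=> 0); split=> [i|]; last by rewrite big1.
  by apply: snorm_le0 => // j; rewrite segmentE mulr0.
- by split=> // z _ N; rewrite /pairing big1// => i _; rewrite mul0r.
- by move=> j; rewrite mul0r expr0n.
Qed.

Lemma witness_sum_le n w N x : witness n w -> \sum_(i < N) w i * `|x i| <= 2 * `|x|.
Proof.
move=> ww; have [->|xn0] := eqVneq x 0.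
  apply: (@le_trans _ _ 0); last by rewrite mulr_ge0.
  by apply: sumr_le0 => i _; rewrite ell20 normr0 mulr0.
have c0 : 0 < `|x| by rewrite normr_gt0.
have S1 := witness_sqr_sum N ww; have S2 := ell2_partial_sum x N.
move: (`|x|) c0 S2 => c c0 S2.
suff : c * \sum_(i < N) w i * `|x i| <= c * (2 * c) by rewrite ler_pM2l.
(* AM-GM balanced by the norm [c]: as the squares of [w] sum to at most 2, it yields [3/2 * c]. *)
apply: (@le_trans _ _ (2^-1 * (c ^+ 2 * \sum_(i < N) w i ^+ 2 + \sum_(i < N) x i ^+ 2)));
  last first.
  have := ler_wpM2l (sqr_ge0 c) S1.
  move: (\sum_(i < N) x i ^+ 2) S2 (c ^+ 2 * _) => A hA B hB.
  have -> : c * (2 * c) = 2 * c ^+ 2 by ring.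
  have := sqr_ge0 c; lra.
rewrite !mulr_sumr -big_split mulr_sumr; apply: ler_sum => i _ /=.
rewrite -subr_ge0 -[x i ^+ 2]real_normK ?num_real//.
have -> : 2^-1 * (c ^+ 2 * w i ^+ 2 + `|x i| ^+ 2) - c * (w i * `|x i|) =
  2^-1 * (c * w i - `|x i|) ^+ 2 by field.
by rewrite mulr_ge0 ?invr_ge0 ?ler0n ?sqr_ge0.
Qed.

Lemma has_sup_witness n x : has_sup [set r : R | exists w N, witness n w /\
  r = \sum_(i < N) w i * `|x i|].
Proof.
split; last by exists (2 * `|x|) => r [w [N [ww ->]]]; exact: witness_sum_le ww.
by exists (\sum_(i < 0) 0 * `|x i|), (fun=> 0), 0%N; split=> //; exact: witness0.
Qed.

Lemma witness_norm_ge n x w N : witness n w -> \sum_(i < N) w i * `|x i| <= witness_norm n x.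
Proof. by move=> ww; apply: sup_upper_bound; [exact: has_sup_witness | exists w, N]. Qed.

Lemma witness_norm_le n x (M : R) :
  (forall w N, witness n w -> \sum_(i < N) w i * `|x i| <= M) -> witness_norm n x <= M.
Proof. by move=> h; apply: ge_sup; [exact: (has_sup_witness n x).1 | move=> r [w [N [ww ->]]];
  exact: h]. Qed.

Lemma witness_norm_ge0 n x : 0 <= witness_norm n x.
Proof. by have := witness_norm_ge x 0 (witness0 n); rewrite big_ord0. Qed.

Lemma witness_norm_le2 n x : witness_norm n x <= 2 * `|x|.
Proof. by apply: witness_norm_le => w N; exact: witness_sum_le. Qed.

Lemma witness_normD n x y : witness_norm n (x + y) <= witness_norm n x + witness_norm n y.
Proof.
apply: witness_norm_le => w N ww.
apply: le_trans (lerD (witness_norm_ge x N ww) (witness_norm_ge y N ww)).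
rewrite -big_split /=; apply: ler_sum => i _; rewrite -mulrDr.
exact: ler_wpM2l (ww.1 i) _ _ (ler_normD (x i) (y i)).
Qed.

Lemma witness_normZ n (c : R) x : witness_norm n (c *: x) = `|c| * witness_norm n x.
Proof.
have le (d : R) z : witness_norm n (d *: z) <= `|d| * witness_norm n z.
  apply: witness_norm_le => w N ww.
  apply: le_trans (ler_wpM2l (normr_ge0 d) (witness_norm_ge z N ww)).
  by rewrite mulr_sumr; apply: ler_sum => i _; rewrite ell2Z normrM mulrCA.
apply/eqP; rewrite eq_le le /=; have [->|c0] := eqVneq c 0.
  by rewrite normr0 mul0r witness_norm_ge0.
have := le c^-1 (c *: x); rewrite scalerA mulVf// scale1r normfV.
by rewrite ler_pdivlMl// normr_gt0.
Qed.

End Distortion.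

Theorem mainTheorem1 (R : realType) (lambda : R) (lambda_gt1 : 1 < lambda) :
  exists p : ell2 R -> R,
    [/\ is_norm p,
        equivalent_norms p (fun x : ell2 R => `|x|) &
        forall Y : set (ell2 R),
          submod_closed (mem Y) -> closed Y -> infinite_dimensional Y ->
          exists x y : ell2 R,
            [/\ Y x, Y y, `|x| = 1, `|y| = 1 & p x > lambda * p y]].
Proof.
have l0 : 0 < lambda by lra.
(* The bounds below are [p x >= 1/4 - 4 s >= 21/100] and
   [lambda * p y <= 13 * lambda * s = 13/100]. *)
pose s := (100 * lambda)^-1.
have s0 : 0 < s by rewrite invr_gt0 mulr_gt0.
have ls : lambda * s = 100^-1 by rewrite /s; field; rewrite gt_eqF.
have s100 : s <= 100^-1 by rewrite -ls ler_peMl ?ltW.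
have [n hn] := @separating_witnesses R s s0 ltac:(lra).
(* The term [s * |x|] supplies definiteness and the lower bound of the equivalence, and is small
   enough to keep the distortion. *)
pose p (x : ell2 R) : R := s * `|x| + witness_norm n x.
have sp x : s * `|x| <= p x by rewrite lerDl witness_norm_ge0.
exists p; split.
- split=> [x y|c x|x px].
  + rewrite /p addrACA -mulrDr; apply: lerD; last exact: witness_normD.
    by apply: ler_wpM2l; [exact: ltW | exact: ler_normD].
  + have nZ : `|c *: x| = `|c| * `|x| := normrZ c x.
    by rewrite /p nZ witness_normZ mulrDr mulrCA.
  + apply/eqP; rewrite -normr_le0.
    by have := sp x; rewrite px pmulr_rle0.
- exists s, (s + 2); split=> // [|x]; first by lra.
  by split=> //; rewrite /p mulrDl lerD2l witness_norm_le2.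
move=> Y /submod_closed_subspace sY _ iY.
have [a [P [bP hP]]] := exists_block_probabilities sY iY s0 ltac:(lra).
have [[I1 [c1 [w1 H1]]] [I2 [c2 [w2 H2]]]] := hn a P bP.
have [x [u [Yx x1 xu hu]]] := hP I1 c1 w1.
have [y [v [Yy y1 yv hv]]] := hP I2 c2 w2.
exists x, y; split=> //.
have px : 4^-1 - 4 * s <= p x.
  have [w [N [ww hw]]] := H1 u hu.
  have := witness_normD n x (u - x); rewrite addrC subrK.
  have := witness_norm_le2 n (u - x); rewrite distrC.
  have := le_trans hw (witness_norm_ge u N ww).
  rewrite /p x1; lra.
have py : p y <= 13 * s.
  have := witness_normD n v (y - v); rewrite addrC subrK.
  have := witness_norm_le2 n (y - v).
  have := witness_norm_le (H2 v hv).
  rewrite /p y1; lra.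
apply: le_lt_trans (ler_wpM2l (ltW l0) py) _; apply: lt_le_trans px.
by rewrite mulrCA ls; lra.
Qed.
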